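(* Let $X$ be a finite poset and $Y$ a finite totally ordered set. Let $\Psi$ be a set of pairs $(x_1,x_2)$ of elements of $X$ with $x_1<x_2$. Let $T$ be the set of tableaux $f:X\to Y$ such that $f(x_1)\le f(x_2)$ whenever $x_1\le x_2$, and $f(x_1)<f(x_2)$ whenever $(x_1,x_2)\in\Psi$. Let $E\subseteq X\times Y$ contain $\bigcup_{f\in T}f$. Then the tableau complex $\Delta(X,Y,T,E)$ is (1) homeomorphic to a ball or a sphere; (2) vertex-decomposable, and hence shellable; and (3) a manifold with (possibly empty) boundary whose interior faces are exactly those faces (set-valued tableaux) $F$ such that every tableau $f\subseteq F$ lies in $T$.
   Context: A tableau is a function $f:X\to Y$, identified with its graph $\{(x,f(x))\}\subseteq X\times Y$. A set-valued tableau is a subset $F\subseteq X\times Y$; write $F(x)=\{y:(x,y)\in F\}$, and for a tableau $f$, ''$f\subseteq F$'' means $f(x)\in F(x)$ for all $x$. Given a set $T$ of tableaux and $E\subseteq X\times Y$ containing every $f\in T$, put $v_{(x,y)}:=E\setminus\{(x,y)\}$ for $(x,y)\in E$. The tableau complex $\Delta(X,Y,T,E)$ is the simplicial complex on ground set $\{v_{(x,y)}:(x,y)\in E\}$ whose faces are the sets $\{v_{(x,y)}:(x,y)\in E\setminus F\}$ for $F\subseteq E$ containing some $f\in T$; the face is identified with $F$ (so faces of $F$ are the $F'\supseteq F$; facets are the $f\in T$). A simplicial complex is vertex-decomposable (Billera–Provan) if it is a simplex, or it is pure and has a vertex $v$ such that both the deletion $\{C\in\Delta: v\notin C\}$ and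 the link $\{C\in\Delta: v\notin C,\ C\cup\{v\}\in\Delta\}$ are vertex-decomposable. *)

(* Defs.v *)
From mathcomp Require Import all_boot all_order all_algebra.
Set Implicit Arguments.
Unset Strict Implicit.
Unset Printing Implicit Defensive.
Import Order.TTheory GRing.Theory Num.Theory.

(* A simplicial complex on a finite ground set V is a set D : {set {set V}} of
   faces, closed under taking subsets.  Elements of V need not be vertices:
   v is a vertex of D when [set v] \in D.  The void complex set0 (no face at
   all) is distinct from the complex {set0} whose only face is empty. *)
Section Complexes.
Local Open Scope set_scope.
Variable V : finType.
Implicit Types (D : {set {set V}}) (v : V) (F G S : {set V}).

Definition simplicial_complex D : Prop :=
  forall F G, F \in D -> G \subset F -> G \in D.

Definition facets D : {set {set V}} :=
  [set F in D | [forall G in D, (F \subset G) ==> (G == F)]].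

Definition pure D : Prop :=
  forall F G, F \in facets D -> G \in facets D -> #|F| = #|G|.

Definition deletion D v : {set {set V}} := [set C in D | v \notin C].

Definition link D v : {set {set V}} :=
  [set C in D | (v \notin C) && (v |: C \in D)].

(* The void complex is counted as a (degenerate) simplex.  Deletions and links
   of vertices are never void, so for a nonvoid complex this convention has no
   effect on vertex-decomposability. *)
Definition is_simplex D : Prop :=
  D = set0 \/ exists S : {set V}, D = powerset S.

Inductive vertex_decomposable D : Prop :=
| VD_simplex : is_simplex D -> vertex_decomposable D
| VD_vertex v : pure D -> [set v] \in D ->
    vertex_decomposable (deletion D v) -> vertex_decomposable (link D v) ->
    vertex_decomposable D.

(* Each facet meets the union of the preceding ones in a pure subcomplex of
   codimension one. *)
Definition shelling D (s : seq {set V}) : Prop :=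
  [/\ uniq s, s =i facets D &
      forall i, 0 < i < size s ->
      forall G, G \in facets (powerset (nth set0 s i) :&:
                              \bigcup_(j < i) powerset (nth set0 s j)) ->
        #|G|.+1 = #|nth set0 s i| ].

Definition shellable D : Prop := pure D /\ exists s, shelling D s.

Definition boundary_ridge D S : bool :=
  (S \in D) &&
  [exists F, ([set G in facets D | S \subset G] == [set F])
             && (#|F| == #|S|.+1)].

(* The subcomplex generated by the codimension-one faces lying in exactly one
   facet.  The boundary complex of a 0-ball is {set0}, and that of a sphere is
   void; so the empty face of D is interior exactly when D has no boundary. *)
Definition boundary_complex D : {set {set V}} :=
  [set G : {set V} | [exists S, boundary_ridge D S && (G \subset S)]].

Definition interior_face D F : Prop := F \in D /\ F \notin boundary_complex D.

End Complexes.

Section Tableaux.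
Local Open Scope set_scope.
Variables X Y : finType.
Implicit Types (f : {ffun X -> Y}) (T : {set {ffun X -> Y}}).
Implicit Types (E F : {set X * Y}).

Definition graph f : {set X * Y} := [set p | f p.1 == p.2].

Definition vtx E (p : X * Y) : {set X * Y} := E :\ p.

Definition face_of E F : {set {set X * Y}} := [set vtx E p | p in E :\: F].

Definition is_face T E F : bool :=
  (F \subset E) && [exists f in T, graph f \subset F].

Definition tableau_complex T E : {set {set {set X * Y}}} :=
  [set face_of E F | F : {set X * Y} & is_face T E F].

Lemma tableau_complexP T E : simplicial_complex (tableau_complex T E).
Proof.
move=> C D /imsetP[F]; rewrite inE => /andP[sFE /exists_inP[f fT sfF]] -> sDC.
have DE : D = face_of E [set p in E | vtx E p \notin D].
  apply/setP => c; apply/idP/imsetP => [cD|[p]].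
    have /imsetP[p] := subsetP sDC c cD.
    rewrite inE => /andP[_ pE] cE; exists p => //.
    by rewrite !inE pE andbT /= negbK -cE.
  by rewrite !inE => /andP[+ pE] ->; rewrite pE /= negbK.
rewrite DE; apply: imset_f; rewrite inE; apply/andP; split.
  by apply/subsetP => p; rewrite inE => /andP[].
apply/exists_inP; exists f => //; apply/subsetP => p pf.
have pF := subsetP sfF p pf; have pE := subsetP sFE p pF.
rewrite inE pE /=; apply: contraL pF => /(subsetP sDC)/imsetP[q].
rewrite inE => /andP[qF qE] /setP/(_ p); rewrite !inE eqxx pE /= andbT.
by move/esym/negbFE/eqP ->.
Qed.

End Tableaux.

Definition order_tableaux (dX dY : Order.disp_t) (X : finPOrderType dX)
    (Y : finOrderType dY) (Psi : {set X * X}) : {set {ffun X -> Y}} :=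
  finset (fun f : {ffun X -> Y} =>
    [forall x1, forall x2, (x1 <= x2)%O ==> (f x1 <= f x2)%O]
    && [forall p in Psi, (f p.1 < f p.2)%O]).

From mathcomp Require Import boolp classical_sets reals topology normedtype.
Import numFieldNormedType.Exports.

Section Topology.
Local Open Scope classical_set_scope.
Local Open Scope ring_scope.
Variable R : realType.

Definition homeomorphism (S T : topologicalType) (A : set S) (B : set T)
    (f : S -> T) (g : T -> S) : Prop :=
  [/\ {within A, continuous f}, {within B, continuous g},
      (forall x, A x -> B (f x) /\ g (f x) = x) &
      (forall y, B y -> A (g y) /\ f (g y) = y)].

Definition homeomorphic (S T : topologicalType) (A : set S) (B : set T) : Prop :=
  exists f g, homeomorphism A B f g.

Definition euclidean_ball (d : nat) : set 'rV[R]_d :=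
  [set x : 'rV[R]_d | \sum_i x ord0 i ^+ 2 <= 1].

(* The sphere of dimension d - 1; for d = 0 it is empty. *)
Definition euclidean_sphere (d : nat) : set 'rV[R]_d :=
  [set x : 'rV[R]_d | \sum_i x ord0 i ^+ 2 = 1].

(* For d = 0 the half-space is the whole point R^0 and its bounding hyperplane
   is empty. *)
Definition half_space (d : nat) : set 'rV[R]_d :=
  [set x : 'rV[R]_d | forall i : 'I_d, i = 0%N :> nat -> 0 <= x ord0 i].

Definition half_space_boundary (d : nat) : set 'rV[R]_d :=
  [set x : 'rV[R]_d | exists i : 'I_d, i = 0%N :> nat /\ x ord0 i = 0].

(* M, a subspace of R^n (hence Hausdorff and second countable), is a
   topological d-manifold with boundary B: every point has a chart from an open
   neighbourhood in M onto an open subset of the half-space, under which B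
   corresponds to the bounding hyperplane.  By invariance of domain M
   determines B. *)
Definition manifold_with_boundary (n d : nat) (M B : set 'rV[R]_n) : Prop :=
  B `<=` M /\
  forall p, M p -> exists (U : set 'rV[R]_n) (W : set 'rV[R]_d) f g,
    [/\ open U, U p, open W,
        homeomorphism (M `&` U) (@half_space d `&` W) f g &
        forall x, (M `&` U) x -> (B x <-> half_space_boundary (f x))].

Definition support (V : finType) (w : 'rV[R]_#|V|) : {set V} :=
  finset (fun v => w ord0 (enum_rank v) != 0).

(* Geometric realization in barycentric coordinates indexed by V. *)
Definition realization (V : finType) (D : {set {set V}}) : set 'rV[R]_#|V| :=
  [set w : 'rV[R]_#|V| | [/\ forall i, 0 <= w ord0 i, \sum_i w ord0 i = 1 &
               support w \in D]].

End Topology.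

Arguments euclidean_ball R d : clear implicits.
Arguments euclidean_sphere R d : clear implicits.
Arguments half_space R d : clear implicits.
Arguments half_space_boundary R d : clear implicits.
Arguments realization R {V} D.
Arguments manifold_with_boundary {R n} d M B.

(* Main.v *)
Require Import Defs.
From mathcomp Require Import all_boot all_order all_algebra fingroup perm.
From mathcomp Require Import ring lra.

(* The facets of the tableau complex are the complements E \ f of the tableaux
   f in T.  Add them along a linear extension of the pointwise order on T.  When
   f is added, let A be the set of points p of E outside f such that inserting p
   into f gives an earlier tableau, and let G be the rest of E \ f.
   - Taking the first entry where an earlier e is below f shows that the new
     facet meets the earlier ones exactly in the faces not containing A; this is
     the shelling condition.
   - Every tableau inside f together with A is in T and no later than f; hence
     the faces of the new facet that contain G meet no other part of the old
     boundary.
   The new facet is therefore the region between 0 and the function "min over G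
   of the barycentric coordinates" above a part of the old boundary, and that
   function vanishes on the rest of the old boundary.  If the old complex is a
   ball, a radial rescaling makes the union a ball again, carrying boundary to
   boundary; no collar or Schoenflies theorem is needed.  The set G is empty only
   if every tableau inside E belongs to T, and then the complex is a join of
   boundaries of simplices, which the minimum over each block identifies with
   the space of rays of a vector space, that is, with a sphere. *)

Set Implicit Arguments.
Unset Strict Implicit.
Unset Printing Implicit Defensive.
Import Order.TTheory.
Local Open Scope set_scope.

(** * Tableau complexes *)

(** Vertex-decomposability is not read off the shelling: it has its own recursion, on the set of
    entries that tableaux may use, in which the deletion and the link of a vertex force or forbid
    one entry. The obstacle is topological. Recognising the union of a ball and a facet would call
    for a gluing theorem, so the induction carries an explicit homeomorphism onto the Euclidean
    ball. In its polar coordinates the union becomes a star-shaped region whose radius in direction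
    u is 1 + k(u), with k(u) the minimum over G at the boundary point in that direction. The
    boundary is therefore needed at every stage, in a form that does not mention ridges: a face
    belongs to it when it avoids both a member of T and a function inside E but outside T. Negating
    this form gives the description of the interior faces. The homeomorphisms onto balls and spheres
    start from compact realizations, so only one direction needs a continuity proof and the inverse
    may be defined by cases. Manifold charts are built on the standard ball and sphere and then
    transported. *)

Section Relabel.
Variables (U V : finType) (h : U -> V).
Hypothesis hI : injective h.
Implicit Types (D : {set {set U}}) (A B C : {set U}).

(** The vertices of [tableau_complex] are the sets [vtx E p]; the work is done on a copy whose
    vertices are the pairs, and carried over by an injective renaming. *)
Definition relabel D : {set {set V}} := [set h @: C | C : {set U} in D].

Lemma mem_relabel D C : (h @: C \in relabel D) = (C \in D).
Proof. by rewrite mem_imset//; exact: imset_inj. Qed.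

Lemma relabelS A B : (h @: A \subset h @: B) = (A \subset B).
Proof.
apply/idP/idP => [/subsetP sAB|]; last exact: imsetS.
by apply/subsetP => x xA; rewrite -(mem_imset _ _ hI); apply: sAB; exact: imset_f.
Qed.

Lemma facets_relabel D : facets (relabel D) = relabel (facets D).
Proof.
apply/setP => C'; apply/idP/imsetP => [|[C]].
  rewrite inE => /andP[/imsetP[C CD ->] /forallP mC]; exists C => //.
  rewrite inE CD; apply/forallP => B; apply/implyP => BD; apply/implyP => CB.
  have /implyP/(_ _)/implyP/(_ _)/eqP := mC (h @: B).
  by rewrite mem_relabel relabelS => /(_ BD CB) /(imset_inj hI) ->.
rewrite inE => /andP[CD /forallP mC] ->; rewrite inE mem_relabel CD.
apply/forallP => B'; apply/implyP => /imsetP[B BD ->]; apply/implyP.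
rewrite relabelS => CB; have /implyP/(_ BD)/implyP/(_ CB)/eqP -> := mC B.
by rewrite eqxx.
Qed.

Lemma pure_relabel D : pure D -> pure (relabel D).
Proof.
move=> pD A' B'; rewrite facets_relabel => /imsetP[A fA ->] /imsetP[B fB ->].
by rewrite !card_imset//; exact: pD.
Qed.

Lemma imsetU1 v C : h @: (v |: C) = h v |: h @: C.
Proof. by rewrite imsetU imset_set1. Qed.

Lemma deletion_relabel D v : deletion (relabel D) (h v) = relabel (deletion D v).
Proof.
apply/setP => C'; rewrite inE; apply/andP/imsetP => [[/imsetP[C CD ->]]|[C]].
  by rewrite mem_imset// => vC; exists C => //; rewrite inE CD.
by rewrite inE => /andP[CD vC] ->; rewrite mem_relabel mem_imset.
Qed.

Lemma link_relabel D v : link (relabel D) (h v) = relabel (link D v).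
Proof.
apply/setP => C'; rewrite inE; apply/and3P/imsetP => [[/imsetP[C CD ->]]|[C]].
  rewrite -imsetU1 mem_relabel mem_imset// => vC vCD.
  by exists C => //; rewrite inE CD vC.
rewrite inE => /and3P[CD vC vCD] ->.
by rewrite -imsetU1 !mem_relabel mem_imset.
Qed.

Lemma vertex_decomposable_relabel D :
  vertex_decomposable D -> vertex_decomposable (relabel D).
Proof.
elim=> {}D.
  move=> [->|[S ->]]; apply: VD_simplex; [left; exact: imset0|right].
  exists (h @: S); apply/setP => C'; rewrite powersetE; apply/imsetP/idP.
    by move=> [C]; rewrite powersetE => CS ->; exact: imsetS.
  move=> /subsetP CS; exists (h @^-1: C').
    rewrite powersetE; apply/subsetP => x; rewrite inE => /CS.
    by rewrite mem_imset.
  apply/setP => v; apply/idP/imsetP => [vC|[x]]; last by rewrite inE => ? ->.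
  by have /imsetP[x xS vE] := CS v vC; exists x => //; rewrite inE -vE.
move=> v pD vD _ IHd _ IHl; apply: (@VD_vertex _ _ (h v)).
- exact: pure_relabel.
- by rewrite -imset_set1 mem_relabel.
- by rewrite deletion_relabel.
- by rewrite link_relabel.
Qed.

Lemma boundary_ridge_relabel D C :
  boundary_ridge (relabel D) (h @: C) = boundary_ridge D C.
Proof.
rewrite /boundary_ridge mem_relabel; congr (_ && _).
have fE : [set G in facets (relabel D) | h @: C \subset G] =
    relabel [set G in facets D | C \subset G].
  apply/setP => B'; rewrite facets_relabel inE; apply/andP/imsetP.
    by move=> [/imsetP[B fB ->]]; rewrite relabelS => CB; exists B => //;
      rewrite inE fB.
  by move=> [B]; rewrite inE => /andP[fB CB] ->; rewrite mem_relabel relabelS.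
apply/existsP/existsP => -[F /andP[/eqP FE /eqP cF]].
  have : F \in relabel [set G in facets D | C \subset G] by rewrite -fE FE set11.
  move=> /imsetP[B BD FB]; exists B; move: cF; rewrite FB !card_imset// => ->.
  rewrite eqxx andbT; apply/eqP; apply: (imset_inj (imset_inj hI)).
  by rewrite imset_set1 -FB -FE fE.
exists (h @: F); rewrite fE FE !card_imset// cF eqxx andbT.
by rewrite /relabel imset_set1.
Qed.

Lemma boundary_complex_relabel D :
  boundary_complex (relabel D) = relabel (boundary_complex D).
Proof.
apply/setP => C'; rewrite inE; apply/existsP/imsetP.
  move=> [S' /andP[rS CS]]; have /imsetP[S SD SE] : S' \in relabel D by case/andP: rS.
  have CE : C' = h @: (h @^-1: C').
    apply/setP => v; apply/idP/imsetP => [vC|[x]]; last by rewrite inE => ? ->.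
    have := subsetP CS v vC; rewrite SE => /imsetP[x _ vE].
    by exists x => //; rewrite inE -vE.
  exists (h @^-1: C') => //; rewrite inE; apply/existsP; exists S.
  by rewrite -relabelS -CE -SE CS andbT -boundary_ridge_relabel -SE.
move=> [C]; rewrite inE => /existsP[S /andP[rS CS]] ->; exists (h @: S).
by rewrite boundary_ridge_relabel rS relabelS.
Qed.

End Relabel.

(** A maximal face G of the intersection lies in an earlier facet j, so it misses p and is contained
    in facet i without p. That face lies in facet k, hence in the intersection, and maximality makes
    it equal to G. *)
Lemma shelling_criterion (V : finType) (D : {set {set V}}) (s : seq {set V}) :
  uniq s -> s =i facets D ->
  (forall i j, j < i < size s -> exists p k,
     [/\ p \in nth set0 s i, p \notin nth set0 s j, k < i &
         nth set0 s i :\ p \subset nth set0 s k]) ->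
  shelling D s.
Proof.
move=> us sD H; split => // i /andP[_ si] G; rewrite inE => /andP[].
rewrite inE powersetE => /andP[Gi /bigcupP[j _]]; rewrite powersetE => Gj /forallP mG.
have [|p [k [pi pj ki ik]]] := H i j; first by rewrite ltn_ord.
have /implyP/(_ _)/implyP/(_ _)/eqP := mG (nth set0 s i :\ p).
rewrite !inE subD1set/= => <-; first by rewrite [in RHS](cardsD1 p) pi.
  by apply/bigcupP; exists (Ordinal ki) => //; rewrite powersetE.
apply/subsetP => x xG; rewrite !inE (subsetP Gi)// andbT.
by apply: contraNneq pj => <-; exact: (subsetP Gj).
Qed.

(** * Complements of graphs: facets and boundary *)

Section TableauComplex.
Variables X Y : finType.
Local Notation U := (X * Y)%type.
Implicit Types (f g e : {ffun X -> Y}) (T : {set {ffun X -> Y}}).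
Implicit Types (C E F : {set U}) (p : U).

Lemma in_graph f p : (p \in graph f) = (f p.1 == p.2).
Proof. by rewrite inE. Qed.

Lemma card_graph f : #|graph f| = #|X|.
Proof.
have -> : graph f = [set (x, f x) | x in [set: X]].
  apply/setP => -[x y]; rewrite in_graph /=; apply/eqP/imsetP.
    by move=> <-; exists x.
  by move=> [x' _ [-> ->]].
by rewrite card_imset ?cardsT// => x x' [].
Qed.

Lemma graph_inj : injective (@graph X Y).
Proof.
move=> f g /setP fg; apply/ffunP => x; have := fg (x, f x).
by rewrite !in_graph eqxx => /esym/eqP.
Qed.

Lemma subset_graph f g : (graph f \subset graph g) = (f == g).
Proof.
apply/idP/eqP => [fg|->//]; apply: graph_inj; apply/eqP.
by rewrite eqEcard fg !card_graph leqnn.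
Qed.

(** A face is stored as the set of entries removed from E, so that facets are complements of graphs
    and the order of faces is inclusion. *)
Definition complex T E : {set {set U}} :=
  [set C : {set U} | [exists f in T, C \subset E :\: graph f]].

Lemma complexP T E C :
  reflect (exists2 f, f \in T & C \subset E :\: graph f) (C \in complex T E).
Proof. by rewrite inE; exact: exists_inP. Qed.

Lemma complex_simplicial T E : simplicial_complex (complex T E).
Proof.
move=> A B /complexP[f fT Af] BA; apply/complexP; exists f => //.
exact: subset_trans Af.
Qed.

Definition upd f p : {ffun X -> Y} := [ffun x => if x == p.1 then p.2 else f x].

Lemma graph_upd f p : graph (upd f p) \subset p |: graph f.
Proof.
apply/subsetP => -[x y]; rewrite !inE /= ffunE; case: p => x1 y1 /=.
by rewrite xpair_eqE; case: (x == x1) => /= [/eqP ->|->]; rewrite ?eqxx.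
Qed.

Lemma mem_graph_upd f p : p \in graph (upd f p).
Proof. by rewrite in_graph ffunE eqxx. Qed.

Lemma upd_neq f p : p \notin graph f -> upd f p != f.
Proof. by apply: contraNneq => {1}<-; exact: mem_graph_upd. Qed.

(** The ridge that omits p from the facet of f can lie only in the facets of f and of [upd f p]. *)
Lemma graph_setU1 f g p : graph g \subset p |: graph f -> g = f \/ g = upd f p.
Proof.
move=> /subsetP gf.
have gx x : g x = f x \/ (x = p.1 /\ g x = p.2).
  have := gf (x, g x); rewrite !inE /= eqxx => /(_ isT)/orP[/eqP <-|/eqP]; by auto.
have [e|e] := eqVneq (g p.1) (f p.1).
  left; apply/ffunP => x; have [//|[xE gE]] := gx x; by rewrite xE.
right; apply/ffunP => x; rewrite ffunE; have [->|xp] := eqVneq x p.1.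
  by have [/eqP|[]//] := gx p.1; rewrite (negbTE e).
by have [//|[xE]] := gx x; rewrite xE eqxx in xp.
Qed.

Section Facets.
Variables (T : {set {ffun X -> Y}}) (E : {set U}).
Hypothesis TE : forall f, f \in T -> graph f \subset E.

Lemma card_facet f : f \in T -> #|E :\: graph f| = #|E| - #|X|.
Proof.
move=> fT; rewrite cardsD -(card_graph f); congr (_ - #|pred_of_set _|).
by apply/setIidPr; exact: TE.
Qed.

Lemma facetsE : facets (complex T E) = [set E :\: graph f | f in T].
Proof.
apply/setP => C; apply/idP/imsetP => [|[f fT ->]].
  rewrite inE => /andP[/complexP[f fT Cf] /forallP mC]; exists f => //.
  have /implyP/(_ _)/implyP/(_ Cf)/eqP -> // := mC (E :\: graph f).
  by apply/complexP; exists f.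
rewrite inE; apply/andP; split; first by apply/complexP; exists f.
apply/forallP => B; apply/implyP => /complexP[g gT Bg]; apply/implyP => fB.
by rewrite eq_sym eqEcard fB (leq_trans (subset_leq_card Bg))// !card_facet.
Qed.

Lemma complex_pure : pure (complex T E).
Proof.
by move=> A B; rewrite facetsE => /imsetP[f fT ->] /imsetP[g gT ->];
  rewrite !card_facet.
Qed.

Lemma facet_inj f g : f \in T -> g \in T ->
  E :\: graph f \subset E :\: graph g -> f = g.
Proof.
move=> fT gT fg; apply/eqP; rewrite eq_sym -subset_graph; apply/subsetP => p pg.
apply: contraLR pg => pf; have pE : p \in E \/ p \notin E by case: (p \in E); auto.
case: pE => [pE|]; last by apply: contra => /(subsetP (TE gT)).
by have := subsetP fg p; rewrite !in_setD pf pE => /(_ isT)/andP[].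
Qed.

(** Any function inside E and outside T may witness that C is on the boundary, not only a neighbour
    of a tableau. The interior criterion and the recursion over ideals both use this form. *)
Definition boundary : {set {set U}} :=
  [set C in complex T E | [exists g, [&& g \notin T, graph g \subset E & C
    \subset E :\: graph g]]].

Lemma boundaryP C : reflect (exists f g, [/\ f \in T, g \notin T, graph g \subset E,
    C \subset E :\: graph f & C \subset E :\: graph g]) (C \in boundary).
Proof.
rewrite inE; apply: (iffP andP) => [[/complexP[f fT Cf] /existsP[g /and3P[gT gE Cg]]]|].
  by exists f, g.
move=> [f [g [fT gT gE Cf Cg]]]; split; first by apply/complexP; exists f.
by apply/existsP; exists g; rewrite gT gE.
Qed.

(* Walk from f to g one entry at a time and stop where the walk leaves T. *)
Lemma exchange_step f g : f \in T -> g \notin T ->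
  exists e p, [/\ e \in T, upd e p \notin T &
    graph e \subset graph f :|: graph g /\ p \in graph g].
Proof.
move: {2}#|graph g :\: graph f| (leqnn #|graph g :\: graph f|) => n.
elim: n f => [|n IH] f.
  rewrite leqn0 cards_eq0 setD_eq0 subset_graph => /eqP -> fT; by rewrite fT.
move=> le fT gT; have [|] := boolP (graph g :\: graph f == set0).
  by rewrite setD_eq0 subset_graph => /eqP e; rewrite -e (negbTE gT) in fT.
move=> /set0Pn[p]; rewrite inE => /andP[pf pg].
have [uT|uT] := boolP (upd f p \in T); last first.
  by exists f, p; split => //; split => //; exact: subsetUl.
have [||//|e [q [eT qT [ef qg]]]] := IH (upd f p) => //.
  rewrite -ltnS; apply: leq_trans le; apply: proper_card; apply/properP; split.
    apply/subsetP => -[x y]; rewrite !inE /= ffunE => /andP[xp gx]; rewrite gx andbT.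
    move: xp; case: (x =P p.1) => // xE; rewrite xE in gx.
    by move: pg; rewrite in_graph => /eqP <-; rewrite gx.
  by exists p; rewrite !in_setD pg ?pf ?mem_graph_upd.
exists e, q; split => //; split => //; apply: (subset_trans ef).
rewrite subUset subsetUr andbT (subset_trans (graph_upd _ _))// subUset subsetUl andbT.
by rewrite sub1set inE pg orbT.
Qed.

(** If S lies in the facet of f alone and misses p there, [upd f p] also avoids S and so cannot be
    in T. Conversely [exchange_step] gives e in T with [upd e p] outside T; the ridge omitting p
    from the facet of e contains C, and by [graph_setU1] it lies in no other facet. *)
Lemma boundary_complexE : boundary_complex (complex T E) = boundary.
Proof.
apply/setP => C; rewrite inE; apply/existsP/boundaryP.
  move=> [S /andP[/andP[_ /existsP[F /andP[/eqP FE /eqP cF]]] CS]].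
  have : F \in [set F] by rewrite set11.
  rewrite -FE inE facetsE => /andP[/imsetP[f fT Ff] SF].
  have [p] : exists p, p \in F :\: S.
    by apply/set0Pn; rewrite -card_gt0 cardsDS// cF subSn// subnn.
  rewrite inE => /andP[pS pF]; have := pF; rewrite Ff inE => /andP[pf pE].
  have Sg : S \subset E :\: graph (upd f p).
    apply/subsetP => q qS; have := subsetP SF q qS; rewrite Ff !in_setD => /andP[qf ->].
    rewrite andbT; apply: contra qf => /(subsetP (graph_upd _ _)).
    by rewrite in_setU1 => /orP[/eqP qp|//]; rewrite -qp qS in pS.
  exists f, (upd f p); split => //; last exact: subset_trans Sg.
  - apply/negP => uT; have : E :\: graph (upd f p) \in [set F].
      by rewrite -FE inE facetsE Sg andbT; apply: imset_f.
    rewrite inE => /eqP eF; have := upd_neq pf.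
    have -> : upd f p = f by apply: facet_inj => //; rewrite eF Ff.
    by rewrite eqxx.
  - apply: subset_trans (graph_upd f p) _; rewrite subUset sub1set pE.
    exact: TE.
  - by rewrite -Ff; exact: subset_trans SF.
move=> [f [g [fT gT gE Cf Cg]]].
have [e [p [eT uT [efg pg]]]] := exchange_step fT gT.
have pe : p \notin graph e.
  apply: contra uT => pe; suff -> : upd e p = e by [].
  apply/ffunP => x; rewrite ffunE; case: eqP => // ->.
  by move: pe; rewrite in_graph => /eqP.
have pE : p \in E by exact: (subsetP gE).
exists (E :\: (p |: graph e)); apply/andP; split; last first.
  apply/subsetP => q qC; have := subsetP Cf q qC; have := subsetP Cg q qC.
  rewrite !in_setD => /andP[qg qE] /andP[qf _]; rewrite qE andbT in_setU1 negb_or.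
  apply/andP; split; first by apply: contraNneq qg => ->.
  by apply/negP => /(subsetP efg); rewrite in_setU (negbTE qf) (negbTE qg).
apply/andP; split.
  by apply/complexP; exists e => //; apply: setDS; exact: subsetUr.
apply/existsP; exists (E :\: graph e); apply/andP; split.
  apply/eqP/setP => F; rewrite [LHS]inE facetsE in_set1;
    apply/andP/eqP => [[/imsetP[e' e'T ->]]|->].
    move=> sub; have [->//|e'E] : e' = e \/ e' = upd e p; last first.
      by rewrite -e'E e'T in uT.
    apply: graph_setU1; apply/subsetP => q qe'; apply: contraLR (qe') => qn.
    have := subsetP sub q; rewrite !in_setD qn (subsetP (TE e'T) q qe') => /(_ isT).
    by case/andP.
  by split; [exact: imset_f|apply: setDS; exact: subsetUr].
rewrite setUC -setDDl [in X in X == _](cardsD1 p) in_setD pe pE /=.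
by rewrite add1n.
Qed.

End Facets.

(* Symmetric difference with {p}: extends vtx E injectively outside E. *)
Definition vlabel E (p : U) : {set U} := if p \in E then vtx E p else p |: E.

Lemma vlabel_inj E : injective (vlabel E).
Proof.
have sp p q : (q \in vlabel E p) = (q == p) (+) (q \in E).
  rewrite /vlabel /vtx; case: ifP => pE; rewrite !inE.
    by case: eqP => [->|]; rewrite ?pE.
  by case: eqP => [->|]; rewrite ?pE.
move=> p q /setP/(_ p); rewrite !sp eqxx.
by case: (p \in E); case: eqP => //.
Qed.

Lemma face_ofE E F : face_of E F = vlabel E @: (E :\: F).
Proof.
by apply: eq_in_imset => p; rewrite inE => /andP[_ pE]; rewrite /vlabel pE.
Qed.

Lemma tableau_complexE T E : (forall f, f \in T -> graph f \subset E) ->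
  tableau_complex T E = relabel (vlabel E) (complex T E).
Proof.
move=> TE; apply/setP => C; apply/imsetP/imsetP => [[F]|[B /complexP[f fT Bf] ->]].
  rewrite inE => /andP[FE /exists_inP[f fT fF]] ->; exists (E :\: F).
    by apply/complexP; exists f => //; exact: setDS.
  exact: face_ofE.
have BE : B \subset E by apply: subset_trans Bf (subsetDl _ _).
exists (E :\: B); last first.
  by rewrite face_ofE setDDr setDv set0U (setIidPr BE).
rewrite inE /is_face subsetDl /=; apply/exists_inP.
exists f => //; apply/subsetP => p pf; rewrite inE (subsetP (TE f fT))// andbT.
by apply/negP => /(subsetP Bf); rewrite inE pf.
Qed.

End TableauComplex.

(** * Shelling order tableaux *)

(** Take an element satisfying P with the fewest elements strictly below it: a smaller one would
    have fewer still. *)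
Lemma finposet_minimal (d : Order.disp_t) (X : finPOrderType d) (P : pred X) :
  (exists x, P x) -> exists2 x, P x & forall x', (x' < x)%O -> ~~ P x'.
Proof.
move=> [x0 Px0]; pose below (x : X) := [set x' | (x' < x)%O].
case: (@arg_minnP _ x0 P (fun x => #|below x|) Px0) => x Px mx.
exists x => // x' lt; apply: contraTN isT => /mx; rewrite leqNgt.
rewrite proper_card//; apply/properP; split; last by exists x'; rewrite !inE ?ltxx.
by apply/subsetP => x''; rewrite !inE => /lt_trans; exact.
Qed.

Section OrderTableaux.
Variables (dX dY : Order.disp_t) (X : finPOrderType dX) (Y : finOrderType dY).
Variables (Psi : {set X * X}) (E : {set X * Y}).
Hypothesis hPsi : forall x1 x2 : X, (x1, x2) \in Psi -> (x1 < x2)%O.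
Local Notation T := (order_tableaux Y Psi).
Implicit Types (f g e : {ffun X -> Y}) (A C : {set X * Y}) (p : X * Y).

Lemma order_tableauxP f : reflect
  ((forall x1 x2, (x1 < x2)%O -> (f x1 <= f x2)%O) /\
   (forall x1 x2, (x1, x2) \in Psi -> (f x1 < f x2)%O)) (f \in T).
Proof.
rewrite inE; apply: (iffP andP) => -[mf sf]; split.
- move=> x1 x2 /ltW x12.
  by have /forallP/(_ x1)/forallP/(_ x2)/implyP/(_ x12) := mf.
- by move=> x1 x2 x12; have /forallP/(_ (x1, x2))/implyP/(_ x12) := sf.
- apply/forallP => x1; apply/forallP => x2; apply/implyP.
  by rewrite le_eqVlt => /orP[/eqP ->//|]; exact: mf.
- by apply/forallP => -[x1 x2]; apply/implyP; exact: sf.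
Qed.

(** Lowering a value cannot break a constraint towards larger elements, so only the constraints from
    below are assumed. *)
Lemma upd_tableau f p : f \in T -> (p.2 <= f p.1)%O ->
  (forall x, (x < p.1)%O -> (f x <= p.2)%O) ->
  (forall x, (x, p.1) \in Psi -> (f x < p.2)%O) -> upd f p \in T.
Proof.
move=> /order_tableauxP[mf sf] pf mp sp; apply/order_tableauxP;
  split=> x1 x2 x12; rewrite !ffunE.
  case: eqP => [e1|_]; case: eqP => [e2|_] //; last exact: mf.
    by apply: le_trans pf _; rewrite -e1; exact: mf.
  by apply: mp; rewrite -e2.
have x12' := hPsi x12.
case: eqP => [e1|_]; case: eqP => [e2|_]; last exact: sf.
- by rewrite e1 e2 ltxx in x12'.
- by apply: le_lt_trans pf _; rewrite -e1; exact: sf.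
- by apply: sp; rewrite -e2.
Qed.

(** * Vertex-decomposability by restricting the permitted entries *)

Definition restricted A : {set {ffun X -> Y}} := [set f in T | graph f \subset A].

Lemma in_restricted A f : (f \in restricted A) = (f \in T) && (graph f \subset A).
Proof. by rewrite inE. Qed.

(** Induction on the number of permitted entries [A]. At a minimal x where tableaux differ, all
    agree below x, so giving any of them the least value [f0 x] at x leaves a tableau. For the
    vertex [(x, f0 x)] the deletion then forces this value and the link forbids it. The ground set
    [E0] is kept apart from [A] because only the link removes a vertex from it. *)
Lemma restricted_vertex_decomposable A (E0 : {set X * Y}) :
  (forall f, f \in restricted A -> graph f \subset E0) ->
  vertex_decomposable (complex (restricted A) E0).
Proof.
move: {2}#|A|.+1 (ltnSn #|A|) => n; elim: n A E0 => // n IH A E0.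
rewrite ltnS => leA TE0.
pose P x := [exists f in restricted A, exists g in restricted A, f x != g x].
have [/existsP/finposet_minimal[x Px mx]|/existsPn nP] := boolP [exists x, P x];
  last first.
  (* At most one tableau remains: the complex is void, which counts as a simplex, or has a single
     facet. *)
  have [T0|[f fT]] := set_0Vmem (restricted A).
    apply: VD_simplex; left; apply/setP => C; rewrite in_set0.
    by apply/negP => /complexP[f]; rewrite T0 inE.
  apply: VD_simplex; right; exists (E0 :\: graph f); apply/setP => C.
  rewrite powersetE; apply/complexP/idP => [[g gT]|]; last by exists f.
  suff -> : g = f by [].
  apply/ffunP => x; apply: contraNeq (nP x) => gf.
  by apply/exists_inP; exists g => //; apply/exists_inP; exists f.
have /exists_inP[f1 f1T /exists_inP[f2 f2T f12]] := Px.
case: (@Order.TotalTheory.arg_minP _ _ _ f1 (mem (restricted A))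
  (fun f : {ffun X -> Y} => f x) f1T) => f0 f0T f0m.
pose v := (x, f0 x).
have [f3 f3T f3x] : exists2 f, f \in restricted A & f x != f0 x.
  have [e|] := eqVneq (f1 x) (f0 x); last by exists f1.
  by exists f2 => //; rewrite -e eq_sym.
have {}f0T : f0 \in restricted A by [].
have /andP[f0T' f0A] : (f0 \in T) && (graph f0 \subset A) by rewrite -in_restricted.
have [m0 s0] := order_tableauxP _ f0T'.
have updT f : f \in restricted A -> upd f v \in restricted A.
  move=> fT; have := fT; rewrite !in_restricted => /andP[fT' fA].
  have below x' : (x' < x)%O -> f x' = f0 x'.
    move=> /mx; apply: contraNeq => ff0.
    by apply/exists_inP; exists f => //; apply/exists_inP; exists f0.
  rewrite upd_tableau//=.
  - apply: subset_trans (graph_upd _ _) _; rewrite subUset sub1set fA andbT.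
    by apply: (subsetP f0A); rewrite in_graph.
  - exact: f0m.
  - by move=> x' lt; rewrite below//; exact: m0.
  - by move=> x' lt; rewrite below ?hPsi//; exact: s0.
have vE0 : v \in E0 by apply: (subsetP (TE0 f0 f0T)); rewrite in_graph.
have vA : v \in A by apply: (subsetP f0A); rewrite in_graph.
have vgraph f : (v \in graph f) = (f x == f0 x) by rewrite in_graph.
apply: (@VD_vertex _ _ v).
- exact: complex_pure.
- apply/complexP; exists f3 => //; rewrite sub1set in_setD vE0 andbT vgraph.
  exact: f3x.
(* [A'] keeps only the value [f0 x] at x. A face without v that avoids f also avoids [upd f v]. *)
- pose A' := A :\: [set p | (p.1 == x) && (p.2 != f0 x)].
  have -> : deletion (complex (restricted A) E0) v = complex (restricted A') E0.
    have A'P f : (f \in restricted A') = (f \in restricted A) && (f x == f0 x).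
      rewrite !in_restricted -andbA; congr (_ && _); rewrite subsetD; congr (_ && _).
      apply/idP/idP => [dis|/eqP fx].
        apply: contraT => fx; have := disjointFr dis (_ : (x, f x) \in graph f).
        by rewrite in_graph eqxx inE /= eqxx fx => /(_ isT).
      apply/pred0P => -[x' y] /=; rewrite in_graph inE /=.
      by apply/negP => /and3P[/eqP <- /eqP ->]; rewrite fx eqxx.
    apply/setP => C; rewrite inE; apply/andP/complexP.
      move=> [/complexP[f fT Cf] vC]; exists (upd f v).
        by rewrite A'P updT// ffunE /= eqxx.
      apply/subsetP => q qC; have := subsetP Cf q qC; rewrite !in_setD.
      move=> /andP[qf ->]; rewrite andbT; apply: contra qf.
      move=> /(subsetP (graph_upd _ _)); rewrite in_setU1 => /orP[/eqP qv|//].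
      by rewrite -qv qC in vC.
    move=> [f]; rewrite A'P => /andP[fT fx] Cf; split.
      by apply/complexP; exists f.
    by apply/negP => /(subsetP Cf); rewrite in_setD vgraph fx.
  apply: IH; last first.
    move=> f; rewrite inE => /andP[fT fA']; apply: TE0; rewrite inE fT.
    by apply: subset_trans fA' (subsetDl _ _).
  apply: leq_trans leA; apply: proper_card; apply/properP.
  split; first exact: subsetDl.
  exists (x, f3 x); last by rewrite !inE /= eqxx f3x.
  have : f3 \in restricted A by []; rewrite inE => /andP[_ /subsetP]; apply.
  by rewrite in_graph.
- have -> : link (complex (restricted A) E0) v = complex (restricted (A :\ v))
  (E0 :\ v).
    have A'P f : (f \in restricted (A :\ v)) = (f \in restricted A) && (f x != f0 x).
      by rewrite !in_restricted -andbA; congr (_ && _); rewrite subsetD1 vgraph.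
    apply/setP => C; rewrite inE; apply/and3P/complexP.
      move=> [_ vC /complexP[f fT vCf]]; exists f.
        rewrite A'P fT; have := subsetP vCf v; rewrite setU11 in_setD vgraph.
        by move=> /(_ isT)/andP[].
      apply/subsetP => q qC; have := subsetP vCf q;
        rewrite in_setU1 qC orbT => /(_ isT).
      rewrite !in_setD in_set1 => /andP[-> ->]; rewrite andbT.
      by apply: contraNneq vC => <-.
    move=> [f]; rewrite A'P => /andP[fT fx] Cf.
    have Cf' : C \subset E0 :\: graph f.
      by apply: subset_trans Cf _; apply: setSD; exact: subD1set.
    split.
    + by apply/complexP; exists f.
    + by apply/negP => /(subsetP Cf); rewrite in_setD setD11 andbF.
    + apply/complexP; exists f => //; rewrite subUset Cf' andbT sub1set in_setD.
      by rewrite vgraph fx.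
  apply: IH.
    by apply: leq_trans leA; rewrite [X in _ < X](cardsD1 v) vA.
  move=> f; rewrite inE => /andP[fT]; rewrite subsetD1 => /andP[fA vf].
  by rewrite subsetD1 vf andbT; apply: TE0; rewrite inE fT.
Qed.

Hypothesis hE : forall f, f \in T -> graph f \subset E.

Lemma order_vertex_decomposable : vertex_decomposable (complex T E).
Proof.
have -> : T = restricted E.
  apply/setP => f; rewrite [RHS]inE; case: (boolP (f \in T)) => //= fT.
  by rewrite hE.
by apply: restricted_vertex_decomposable => f; rewrite inE => /andP[].
Qed.

(** These are the initial segments of the linear extensions of the pointwise order. Quantifying over
    all of them and removing a maximal element avoids fixing an extension. *)
Definition ideal (T' : {set {ffun X -> Y}}) : Prop := T' \subset T /\
  forall f g, f \in T' -> g \in T -> (forall x, (g x <= f x)%O) -> g \in T'.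

Lemma ideal_full : ideal T. Proof. by []. Qed.

(** Maximise the number of entries weakly below the graph: a larger tableau has at least as many,
    and equality forces equal functions. *)
Lemma ideal_maximal T' : T' != set0 -> exists2 f, f \in T' &
  forall g, g \in T' -> (forall x, (f x <= g x)%O) -> g = f.
Proof.
move=> /set0Pn[f0 f0T]; pose below f := [set p : X * Y | (p.2 <= f p.1)%O].
case: (@arg_maxnP _ f0 (mem T') (fun f => #|below f|) f0T) => f fT mf.
exists f => // g gT fg; have sub : below f \subset below g.
  by apply/subsetP => p; rewrite !inE => /le_trans; apply.
have /setP e : below f = below g by apply/eqP; rewrite eqEcard sub; exact: mf.
apply/ffunP => x; apply: le_anti; rewrite fg andbT.
by have := e (x, g x); rewrite !inE lexx.
Qed.

(** * Adding the last tableau of an ideal *)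

Section IdealStep.
Variables (T' : {set {ffun X -> Y}}) (f : {ffun X -> Y}).
Hypotheses (idT : ideal T') (fT' : f \in T').
Hypothesis fmax : forall g, g \in T' -> (forall x, (f x <= g x)%O) -> g = f.

Let T'' := T' :\ f.
Let S := E :\: graph f.
Definition restriction : {set X * Y} := [set p in S | upd f p \in T''].
Let A := restriction.
Let G := S :\: A.

Let sub_T g : g \in T' -> g \in T. Proof. by case: idT => /subsetP + _; apply. Qed.

Lemma ideal_step : ideal T''.
Proof.
split; first by apply/subsetP => g; rewrite inE => /andP[_ /sub_T].
move=> g g'; rewrite !in_setD1 => /andP[gf gT] g'T le.
rewrite (idT.2 g g' gT g'T le) andbT; apply: contraNneq gf => e.
by apply/eqP/fmax => // x; rewrite -e.
Qed.

Let fE p : p \in graph f -> p \in E.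
Proof. by move: p; apply/subsetP; apply: hE; exact: sub_T. Qed.

Lemma restrictionE p : p \in A -> (p.2 < f p.1)%O /\ upd f p \in T.
Proof.
rewrite inE in_setD1 => /andP[/setDP[pE pf] /andP[uf uT]].
split; last exact: sub_T.
rewrite ltNge; apply: contra uf => le; apply/eqP/fmax => // x.
by rewrite ffunE; case: eqP => [->|].
Qed.

(** At a minimal x with [e x < f x], the values of f below x are at most those of e, so the bounds
    that e obeys at x allow f to be lowered to [e x] there. *)
Lemma earlier_neighbour e : e \in T'' -> exists2 p, p \in A & p \in graph e.
Proof.
rewrite in_setD1 => /andP[ef eT'].
have [|x ex mx] := @finposet_minimal _ X (fun x => (e x < f x)%O).
  apply/existsP; apply: contraNT ef; rewrite negb_exists => /forallP H.
  by apply/eqP/fmax => // x; have := H x; rewrite -leNgt.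
have [me se] := order_tableauxP _ (sub_T eT').
exists (x, e x); last by rewrite in_graph.
have uT : upd f (x, e x) \in T.
  apply: upd_tableau => /=; first exact: sub_T.
  - exact: ltW.
  - by move=> x' lt; apply: le_trans (me _ _ lt); rewrite leNgt mx.
  - by move=> x' lt; apply: le_lt_trans (se _ _ lt); rewrite leNgt mx ?hPsi.
have pf : (x, e x) \notin graph f by rewrite in_graph /= gt_eqF.
rewrite inE in_setD pf (subsetP (hE (sub_T eT'))) ?in_graph//= in_setD1 upd_neq//=.
apply: (idT.2 f) => // x'; rewrite ffunE /=; case: eqP => [->|//].
exact: ltW.
Qed.

(** Since g lies below f, a constraint between x1 and x2 only needs the bound by [f x1] at x2. There
    g has the value of f or a value that can be inserted alone into f, and either satisfies that
    bound. *)
Lemma near_tableau g : graph g \subset graph f :|: A -> g \in T'.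
Proof.
move=> /subsetP gfA.
have gx x : g x = f x \/ (x, g x) \in A.
  have := gfA (x, g x); rewrite in_setU !in_graph eqxx => /(_ isT).
  by move=> /orP[/eqP|]; auto.
have le x : (g x <= f x)%O by have [->//|/restrictionE[/ltW]] := gx x.
have [mf sf] := order_tableauxP _ (sub_T fT').
apply: (idT.2 f) => //; apply/order_tableauxP; split => x1 x2 x12.
  apply: le_trans (le x1) _; have [->|/restrictionE[_ uT]] := gx x2; first exact: mf.
  have [mu _] := order_tableauxP _ uT; have := mu _ _ x12; rewrite !ffunE /= eqxx.
  by rewrite lt_eqF.
apply: le_lt_trans (le x1) _; have [->|/restrictionE[_ uT]] := gx x2; first exact: sf.
have [_ su] := order_tableauxP _ uT; have := su _ _ x12; rewrite !ffunE /= eqxx.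
by rewrite lt_eqF ?hPsi.
Qed.

(** A function avoiding a face that contains G can use only entries of f and of A. *)
Let avoid_near C g : C \subset E -> G \subset C -> graph g \subset E ->
  C \subset E :\: graph g -> g \in T'.
Proof.
move=> CE GC gE Cg; apply: near_tableau; apply/subsetP => p pg.
rewrite in_setU; case: (boolP (p \in graph f)) => //= pf.
have pC : p \notin C by apply/negP => /(subsetP Cg); rewrite in_setD pg.
apply: contraNT pC => pA; apply: (subsetP GC).
by rewrite !in_setD pA pf (subsetP gE).
Qed.

Let updE p : p \in S -> graph (upd f p) \subset E.
Proof.
move=> /setDP[pE _]; apply: subset_trans (graph_upd _ _) _.
by rewrite subUset sub1set pE; apply/subsetP => q; exact: fE.
Qed.

Let avoid_upd C p : C \subset S -> p \notin C -> C \subset E :\: graph (upd f p).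
Proof.
move=> CS pC; apply/subsetP => q qC; have := subsetP CS q qC.
rewrite !in_setD => /andP[qf ->]; rewrite andbT; apply: contra qf.
move=> /(subsetP (graph_upd _ _)); rewrite in_setU1 => /orP[/eqP qp|//].
by rewrite -qp qC in pC.
Qed.

Lemma step_complex : complex T' E = complex T'' E :|: powerset S.
Proof.
apply/setP => C; rewrite in_setU powersetE; apply/complexP/orP.
  move=> [g gT Cg]; have [gf|gf] := eqVneq g f; first by right; rewrite /S -gf.
  by left; apply/complexP; exists g => //; rewrite in_setD1 gf.
move=> [/complexP[g]|CS]; last by exists f.
by rewrite in_setD1 => /andP[_ gT] Cg; exists g.
Qed.

(** If C omits p in A, [upd f p] is an earlier tableau avoiding C; if C contains A,
    [earlier_neighbour] makes every earlier tableau meet C. *)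
Lemma step_facet C : C \subset S -> (C \in complex T'' E) = ~~ (A \subset C).
Proof.
move=> CS; apply/complexP/idP => [[e eT Ce]|/subsetPn[p pA pC]].
  have [p pA pe] := earlier_neighbour eT; apply: contraTN pe => /subsetP/(_ p pA).
  by move=> /(subsetP Ce); rewrite in_setD => /andP[].
exists (upd f p); first by move: pA; rewrite inE => /andP[].
by apply: avoid_upd.
Qed.

(** The removed f is itself the function outside [T''] that avoids C. *)
Lemma step_boundary_facet C : C \subset S -> C \in complex T'' E ->
  C \in boundary T'' E.
Proof.
move=> CS /complexP[e eT Ce]; apply/boundaryP; exists e, f; split => //.
  by rewrite in_setD1 eqxx.
by apply/subsetP => p; exact: fE.
Qed.

(** By [avoid_near] the witness outside [T''] belongs to [T'], so it is f. *)
Lemma step_boundary_interior C : C \in boundary T'' E -> G \subset C -> C \subset S.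
Proof.
move=> /boundaryP[e [g [eT gT gE Ce Cg]]] GC.
have [gf|gf] := eqVneq g f; first by rewrite /S -gf.
have CE : C \subset E by apply: subset_trans Ce (subsetDl _ _).
by move: gT; rewrite in_setD1 gf (avoid_near CE GC gE Cg).
Qed.

(** A witness outside [T'] rules out [G \subset C]. Conversely, if C lies in S and omits p in G,
    [upd f p] is such a witness; if C does not lie in S, an old witness differs from f and still
    serves. *)
Lemma step_boundary C : (C \in boundary T' E) =
  [&& (C \in complex T'' E) || (C \subset S), ~~ (G \subset C) &
      (C \in boundary T'' E) || (C \subset S)].
Proof.
apply/boundaryP/and3P.
  move=> [e [g [eT gT gE Ce Cg]]].
  have CE : C \subset E by apply: subset_trans Ce (subsetDl _ _).
  have gT'' : g \notin T'' by rewrite in_setD1 negb_and gT orbT.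
  split.
  - have [ef|ef] := eqVneq e f; first by rewrite /S -ef Ce orbT.
    by apply/orP; left; apply/complexP; exists e => //; rewrite in_setD1 ef.
  - by apply: contra gT => GC; exact: avoid_near Cg.
  - have [ef|ef] := eqVneq e f; first by rewrite /S -ef Ce orbT.
    by apply/orP; left; apply/boundaryP; exists e, g; split => //; rewrite in_setD1 ef.
move=> [_ nGC]; have [CS _|CS] := boolP (C \subset S).
  have /subsetPn[p /setDP[pS pA] pC] := nGC.
  exists f, (upd f p); split => //.
  - apply: contra pA => uT; rewrite inE pS in_setD1 uT andbT.
    by apply: upd_neq; move: pS; rewrite in_setD => /andP[].
  - exact: updE.
  - exact: avoid_upd.
rewrite orbF => /boundaryP[e [g [eT gT gE Ce Cg]]].
exists e, g; split => //; first by move: eT; rewrite in_setD1 => /andP[].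
move: gT; rewrite in_setD1 negb_and negbK => /orP[/eqP gf|//].
by rewrite /S -gf Cg in CS.
Qed.

Lemma step_restriction_neq0 : T'' != set0 -> A != set0.
Proof.
move=> /set0Pn[e /earlier_neighbour[p pA _]]; by apply/set0Pn; exists p.
Qed.

(** If G were empty, the empty face would contain it and [avoid_near] would put every function
    inside E into [T']. *)
Lemma step_corestriction_neq0 g : graph g \subset E -> g \notin T' -> G != set0.
Proof.
move=> gE; apply: contraNneq => G0; apply: (@avoid_near set0) => //.
- exact: sub0set.
- by rewrite G0.
- exact: sub0set.
Qed.

End IdealStep.

(** The maximal tableau goes last; inserting the entry from [earlier_neighbour] leads to a tableau
    already listed. *)
Lemma ideal_shelling T' : ideal T' -> exists s : seq {ffun X -> Y},
  [/\ uniq s, s =i T' & forall f0 i j, j < i < size s -> exists p k,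
    [/\ p \in E :\: graph (nth f0 s i), p \in graph (nth f0 s j), k < i &
        upd (nth f0 s i) p = nth f0 s k]].
Proof.
move: {2}#|T'|.+1 (ltnSn #|T'|) => n; elim: n T' => // n IH T'; rewrite ltnS => le idT.
have [->|T0] := eqVneq T' set0.
  by exists [::]; split => // [f|f0 i j]; rewrite ?inE ?ltn0 ?andbF.
have [f fT fmax] := ideal_maximal T0.
have [|s [us sT Hs]] := IH (T' :\ f) _ (ideal_step idT fmax).
  by apply: leq_trans le; rewrite [X in _ < X](cardsD1 f) fT.
have fs : f \notin s by rewrite sT in_setD1 eqxx.
exists (rcons s f); split.
- by rewrite rcons_uniq fs.
- move=> g; rewrite mem_rcons inE sT in_setD1.
  by case: eqP => [->|]; rewrite ?fT.
move=> f0 i j; rewrite size_rcons ltnS => /andP[ji].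
rewrite leq_eqVlt => /orP[/eqP ie|is_].
  rewrite !nth_rcons ie ltnn eqxx -ie; rewrite ie in ji; rewrite ie ji.
  have eT : nth f0 s j \in T' :\ f by rewrite -sT mem_nth.
  have [p pA pe] := earlier_neighbour idT fT fmax eT.
  move: (pA); rewrite inE => /andP[pS uT].
  exists p, (index (upd f p) s); split => //; first by rewrite index_mem sT.
  by rewrite nth_rcons index_mem sT uT nth_index// sT.
have [|p [k [pS pj ki up]]] := Hs f0 i j; first by rewrite ji.
exists p, k; rewrite !nth_rcons is_ (ltn_trans ji is_) (ltn_trans ki is_).
by split.
Qed.

Lemma order_shellable : shellable (tableau_complex T E).
Proof.
rewrite tableau_complexE//; set h := vlabel E;
  have hI : injective h := @vlabel_inj _ _ E.
split; first by apply: pure_relabel => //; exact: complex_pure.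
have [s [us sT Hs]] := ideal_shelling ideal_full.
exists [seq h @: (E :\: graph f) | f : {ffun X -> Y} <- s].
have inj : {in s &, injective (fun f : {ffun X -> Y} => h @: (E :\: graph f))}.
  move=> f g; rewrite !sT => fT gT /(imset_inj hI) e.
  by apply: (facet_inj hE) => //; rewrite e.
apply: shelling_criterion.
- by rewrite map_inj_in_uniq.
- move=> C; rewrite facets_relabel// facetsE//; apply/mapP/imsetP.
    by move=> [f]; rewrite sT => fT ->; exists (E :\: graph f) => //; exact: imset_f.
  by move=> [B /imsetP[f fT ->] ->]; exists f => //; rewrite sT.
rewrite size_map => i j /andP[ji is_].
case: s us sT Hs inj is_ => // f0 s us sT Hs inj is_.
have [|p [k [pS pj ki up]]] := Hs f0 i j; first by rewrite ji.
exists (h p), k; rewrite !(nth_map f0) ?(ltn_trans ji is_) ?(ltn_trans ki is_)//.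
rewrite !mem_imset//; split => //; first by rewrite in_setD pj.
rewrite -imset_set1; apply/subsetP => q' /setDP[/imsetP[q qS ->]].
rewrite mem_imset// in_set1 => qp; apply: imset_f.
move: qS; rewrite !in_setD -up => /andP[qf ->]; rewrite andbT.
by apply: contra qf => /(subsetP (graph_upd _ _)); rewrite in_setU1 (negbTE qp).
Qed.

(** A function inside E avoids the complement of F exactly when its graph lies in F, so the
    criterion is the negation of [boundary]. *)
Lemma order_interior_face F : is_face T E F ->
  (interior_face (tableau_complex T E) (face_of E F) <->
   forall f, graph f \subset F -> f \in T).
Proof.
move=> /andP[FE /exists_inP[f0 f0T f0F]].
rewrite /interior_face tableau_complexE// boundary_complex_relabel;
  last exact: vlabel_inj.
rewrite boundary_complexE// face_ofE !mem_relabel; try exact: vlabel_inj.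
have FD f : graph f \subset F -> E :\: F \subset E :\: graph f by exact: setDS.
have DF f : graph f \subset E -> E :\: F \subset E :\: graph f -> graph f \subset F.
  move=> fE /subsetP H; apply/subsetP => p pf; apply: contraLR (pf) => pF.
  by have := H p; rewrite !in_setD pF (subsetP fE)// => /(_ isT)/andP[].
split=> [[_ nb] f fF|H].
  apply: contraNT nb => fT; apply/boundaryP; exists f0, f; split; rewrite ?FD//.
  exact: subset_trans FE.
split; first by apply/complexP; exists f0; rewrite ?FD.
by apply/negP => /boundaryP[e [g [eT gT gE _ /(DF _ gE)/H]]]; rewrite (negbTE gT).
Qed.

End OrderTableaux.

(** * Continuity on subsets *)

From mathcomp Require Import boolp classical_sets reals topology normedtype.
From mathcomp Require Import cardinality realfun.
Import numFieldNormedType.Exports.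
Import GRing.Theory Num.Theory.
Local Open Scope classical_set_scope.
Local Open Scope ring_scope.

(** Equivalent to continuity on the subspace ([cont_onP]), but phrased as limits at the points of A,
    so that the limit laws apply. *)
Definition cont_on (S T : topologicalType) (A : set S) (f : S -> T) : Prop :=
  forall x, A x -> f y @[y --> within A (nbhs x)] --> f x.

Lemma cont_onW (S T : topologicalType) (A : set S) (f : S -> T) :
  continuous f -> cont_on A f.
Proof. by move=> cf x Ax; apply: cvg_trans (cf x); apply: cvg_app;
  exact: cvg_within. Qed.

Lemma cont_onT (S T : topologicalType) (f : S -> T) :
  cont_on setT f -> continuous f.
Proof.
move=> cf x P /(cf x Logic.I) H.
have {}H : nbhs x [set y | setT y -> P (f y)] by [].
by apply: filterS H => y; apply.
Qed.

Section ContOn.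
Variables (R : realType) (S : topologicalType).
Implicit Types (A B : set S) (f g : S -> R).

Lemma cont_onP (T : topologicalType) A (f : S -> T) :
  {within A, continuous f} <-> cont_on A f.
Proof. exact: subspace_continuousP. Qed.

Lemma cont_on_id A : cont_on A id.
Proof. by move=> x Ax; apply: cvg_within. Qed.

Lemma cont_on_sub (T : topologicalType) A B (f : S -> T) :
  A `<=` B -> cont_on B f -> cont_on A f.
Proof.
move=> AB cf x Ax; apply: cvg_trans (cf x (AB _ Ax)); apply: cvg_app.
exact: within_subset.
Qed.

Lemma cont_on_comp (T U : topologicalType) A (B : set T) (f : S -> T)
    (g : T -> U) :
  (forall x, A x -> B (f x)) -> cont_on A f -> cont_on B g ->
  cont_on A (fun x => g (f x)).
Proof.
move=> AB cf cg x Ax; apply: cvg_comp (cg _ (AB _ Ax)) => P.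
move=> /(cf x Ax) H; have {}H : nbhs x (fun y => A y -> B (f y) -> P (f y)) by [].
by apply: filterS H => y H Ay; apply: H => //; exact: AB.
Qed.

Lemma cont_on_ext (T : topologicalType) A (f g : S -> T) :
  {in A, f =1 g} -> cont_on A f -> cont_on A g.
Proof.
move=> fg cf x Ax; rewrite -(fg x (mem_set Ax)); apply: cvg_trans (cf x Ax).
apply: near_eq_cvg; apply: (@filterS _ (nbhs x) _ setT) (filterT) => y _ Ay.
by rewrite fg//; exact: mem_set.
Qed.

Lemma cont_on_cst (T : topologicalType) A (c : T) : cont_on A (fun=> c).
Proof. by move=> x _; exact: cvg_cst. Qed.

Lemma cont_onD A f g : cont_on A f -> cont_on A g -> cont_on A (fun x => f x + g x).
Proof. by move=> cf cg x Ax; apply: cvgD; [exact: cf|exact: cg]. Qed.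

Lemma cont_onN A f : cont_on A f -> cont_on A (fun x => - f x).
Proof. by move=> cf x Ax; apply: cvgN; exact: cf. Qed.

Lemma cont_onB A f g : cont_on A f -> cont_on A g -> cont_on A (fun x => f x - g x).
Proof. by move=> cf cg; apply: cont_onD => //; exact: cont_onN. Qed.

Lemma cont_onM A f g : cont_on A f -> cont_on A g -> cont_on A (fun x => f x * g x).
Proof. by move=> cf cg x Ax; apply: cvgM; [exact: cf|exact: cg]. Qed.

Lemma cont_onV A f : (forall x, A x -> f x != 0) -> cont_on A f ->
  cont_on A (fun x => (f x)^-1).
Proof. by move=> f0 cf x Ax; apply: cvgV; [exact: f0|exact: cf]. Qed.

Lemma cont_on_min A f g : cont_on A f -> cont_on A g ->
  cont_on A (fun x => Num.min (f x) (g x)).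
Proof.
move=> cf cg x Ax.
have minE y : Num.min (f y) (g y) = (f y + g y - `|f y - g y|) / 2.
  by rewrite minr_absE.
under eq_fun do rewrite minE; rewrite minE.
apply: cvgM; last exact: cvg_cst.
apply: cvgB; first by apply: cvgD; [exact: cf|exact: cg].
by apply: cvg_norm; apply: cvgB; [exact: cf|exact: cg].
Qed.

Lemma cont_on_sum (I : Type) (r : seq I) (P : pred I) A (F : I -> S -> R) :
  (forall i, P i -> cont_on A (F i)) -> cont_on A (fun x => \sum_(i <- r | P i) F i x).
Proof.
move=> cF; elim: r => [|i r IH].
  apply: (@cont_on_ext _ _ (fun=> 0)); last exact: cont_on_cst.
  by move=> x _ /=; rewrite big_nil.
apply: (@cont_on_ext _ _ (fun x => if P i then F i x + \sum_(i <- r | P i) F i x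
  else \sum_(i <- r | P i) F i x)).
  by move=> x _ /=; rewrite big_cons.
by case Pi: (P i) => //; apply: cont_onD => //; exact: cF.
Qed.

Lemma cont_on_bigmin (I : Type) (r : seq I) (P : pred I) A (F : I -> S ->
  R) (c : S -> R) :
  cont_on A c ->
  (forall i, P i -> cont_on A (F i)) ->
  cont_on A (fun x => \big[Num.min/c x]_(i <- r | P i) F i x).
Proof.
move=> cc cF; elim: r => [|i r IH].
  apply: (@cont_on_ext _ _ c) => //.
  by move=> x _ /=; rewrite big_nil.
apply: (@cont_on_ext _ _ (fun x => if P i then Num.min (F i x) (\big[Num.min/c
  x]_(i <- r | P i) F i x) else \big[Num.min/c x]_(i <- r | P i) F i x)).
  by move=> x _ /=; rewrite big_cons.
by case Pi: (P i) => //; apply: cont_on_min => //; exact: cF.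
Qed.

Lemma cont_on_row A n (f : S -> 'rV[R]_n) :
  (forall i, cont_on A (fun x => f x ord0 i)) -> cont_on A f.
Proof.
move=> cf x Ax P [Q HQ /filterS]; apply.
have : \forall y \near within A (nbhs x), forall i : 'I_n, Q ord0 i (f y ord0 i).
  apply: filter_forall => i; apply: (cf i x Ax); exact: HQ.
by apply: filterS => y Hy i j; rewrite ord1.
Qed.

Lemma cont_on_coord A n (f : S -> 'rV[R]_n) i :
  cont_on A f -> cont_on A (fun x => f x ord0 i).
Proof.
move=> cf; apply: (@cont_on_comp _ _ A setT f (fun M => M ord0 i)) => //.
by apply: cont_onW; exact: coord_continuous.
Qed.

Lemma cont_onZ A n f (g : S -> 'rV[R]_n) : cont_on A f -> cont_on A g ->
  cont_on A (fun x => f x *: g x).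
Proof.
move=> cf cg; apply: cont_on_row => i.
apply: (@cont_on_ext _ _ (fun x => f x * g x ord0 i)) => [x _|]; first by rewrite mxE.
by apply: cont_onM => //; exact: cont_on_coord.
Qed.

Lemma cont_on_squeeze0 A f g : (forall x, A x -> `|f x| <= g x) ->
  forall x, A x -> g x = 0 -> g y @[y --> within A (nbhs x)] --> g x ->
  f y @[y --> within A (nbhs x)] --> f x.
Proof.
move=> fg x Ax gx0; rewrite gx0 => cg.
have -> : f x = 0 by apply/eqP; rewrite -normr_le0 -gx0 fg.
have cN : (- g y) @[y --> within A (nbhs x)] --> 0 by rewrite -oppr0; exact: cvgN.
apply: (squeeze_cvgr _ cN cg).
apply: (@filterS _ (nbhs x) _ setT) (filterT) => y _ Ay.
by rewrite -ler_norml; exact: fg.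
Qed.

Lemma cont_onU (T : topologicalType) A B (f : S -> T) : closed A -> closed B ->
  cont_on A f -> cont_on B f -> cont_on (A `|` B) f.
Proof.
by move=> cA cB /cont_onP fA /cont_onP fB; apply/cont_onP; exact: withinU_continuous.
Qed.

End ContOn.

(* A compact set is mapped homeomorphically by a continuous injection: images
   of its closed subsets are compact, hence closed. *)
Lemma compact_homeomorphism (S T : topologicalType) (A : set S) (B : set T)
    (f : S -> T) (g : T -> S) :
  hausdorff_space S -> hausdorff_space T ->
  compact A -> cont_on A f ->
  (forall x, A x -> B (f x) /\ g (f x) = x) ->
  (forall y, B y -> A (g y) /\ f (g y) = y) ->
  homeomorphism A B f g.
Proof.
move=> hS hT cA cf fB gA; split => //; first exact/cont_onP.
apply/cont_onP => y By P; rewrite nbhsE => -[O [oO Oy] OP].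
pose C := A `&` ~` O.
have cC : compact C.
  apply: (subclosed_compact _ cA) => [|x []//].
  by apply: closedI; [exact: compact_closed|exact: open_closedC].
have cfC : closed (f @` C).
  apply: compact_closed => //; apply: continuous_compact => //.
  by apply/cont_onP; apply: cont_on_sub cf => x [].
rewrite /within /=.
have : nbhs y (~` (f @` C)).
  apply: open_nbhs_nbhs; split; first exact: closed_openC.
  by move=> [x [Ax nOx] fxy]; apply: nOx; rewrite -(fB x Ax).2 fxy.
apply: filterS => z nz Bz; apply: OP; apply: contrapT => nO; apply: nz.
by exists (g z); [split; [exact: (gA z Bz).1|]|exact: (gA z Bz).2].
Qed.

(** * Norms, gauges and realizations *)

Section EuclideanNorm.
Variables (R : realType) (d : nat).
Implicit Types z : 'rV[R]_d.

Definition nrm2 z : R := Num.sqrt (\sum_i z ord0 i ^+ 2).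

Lemma sumsq_ge0 z : 0 <= \sum_i z ord0 i ^+ 2.
Proof. by apply: sumr_ge0 => i _; exact: sqr_ge0. Qed.

Lemma nrm2_ge0 z : 0 <= nrm2 z. Proof. exact: sqrtr_ge0. Qed.

Lemma nrm2_sqr z : nrm2 z ^+ 2 = \sum_i z ord0 i ^+ 2.
Proof. by rewrite sqr_sqrtr ?sumsq_ge0. Qed.

Lemma coord_le_nrm2 z i : `|z ord0 i| <= nrm2 z.
Proof.
rewrite -sqrtr_sqr ler_sqrt ?sumsq_ge0// (bigD1 i)//= lerDl.
by apply: sumr_ge0 => j _; exact: sqr_ge0.
Qed.

Lemma nrm2_eq0 z : (nrm2 z == 0) = (z == 0).
Proof.
apply/eqP/eqP => [z0|->].
  by apply/rowP => i; apply/eqP; rewrite mxE -normr_le0 -z0 coord_le_nrm2.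
by rewrite /nrm2 big1 ?sqrtr0// => i _; rewrite mxE expr0n.
Qed.

Lemma nrm2_gt0 z : (0 < nrm2 z) = (z != 0).
Proof. by rewrite lt0r nrm2_eq0 nrm2_ge0 andbT. Qed.

Lemma nrm2Z a z : 0 <= a -> nrm2 (a *: z) = a * nrm2 z.
Proof.
move=> a0; rewrite /nrm2 -[X in X * _](ger0_norm a0) -sqrtr_sqr -sqrtrM ?sqr_ge0//.
by congr Num.sqrt; rewrite mulr_sumr; apply: eq_bigr => i _; rewrite mxE exprMn.
Qed.

Lemma nrm2_unit z : z != 0 -> nrm2 ((nrm2 z)^-1 *: z) = 1.
Proof. by move=> z0; rewrite nrm2Z ?invr_ge0 ?nrm2_ge0// mulVf ?nrm2_eq0. Qed.

Lemma ballE z : euclidean_ball R d z <-> nrm2 z <= 1.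
Proof.
by rewrite /euclidean_ball /= -nrm2_sqr expr_le1// nrm2_ge0.
Qed.

Lemma sphereE z : euclidean_sphere R d z <-> nrm2 z = 1.
Proof.
rewrite /euclidean_sphere /= -nrm2_sqr; split => [/eqP|->]; last exact: expr1n.
by rewrite sqrp_eq1 ?nrm2_ge0// => /eqP.
Qed.

Lemma cont_on_nrm2 (S : topologicalType) (A : set S) (f : S -> 'rV[R]_d) :
  cont_on A f -> cont_on A (fun x => nrm2 (f x)).
Proof.
move=> cf; apply: (@cont_on_comp _ _ _ A setT (fun x => \sum_i f x ord0 i ^+ 2)
  Num.sqrt) => //.
  apply: cont_on_sum => i _.
  by apply: cont_onM; apply: cont_on_coord.
by apply: cont_onW; exact: sqrt_continuous.
Qed.

(** Meant for radial formulas: directions have no limit at the origin, and continuity there comes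
    from a bound g that vanishes at 0. *)
Lemma cont_on_origin (A : set 'rV[R]_d) (f g : 'rV[R]_d -> R) :
  cont_on (A `&` [set z | z != 0]) f -> (forall z, A z -> `|f z| <= g z) ->
  g 0 = 0 -> cont_on A g -> cont_on A f.
Proof.
move=> cf fg g0 cg z Az; have [z0|z0] := eqVneq z 0.
  apply: (cont_on_squeeze0 fg) => //; first by rewrite z0.
  exact: cg.
move=> P /(cf z (conj Az z0)) H.
have {}H : nbhs z [set y | (A `&` [set z | z != 0]) y -> P (f y)] by [].
have : nbhs z [set y | 0 < nrm2 y].
  have : nrm2 y @[y --> z] --> nrm2 z.
    exact: (cont_onT (cont_on_nrm2 (@cont_on_id _ setT))).
  by move=> /cvgr_gt; apply; rewrite nrm2_gt0.
move=> H'; apply: filterS2 H H' => y Hy.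
by rewrite /= nrm2_gt0 => y0 Ay; apply: Hy.
Qed.

(* The two mutually inverse radial maps between the unit ball of a gauge and
   the Euclidean one. *)
Variable G : 'rV[R]_d -> R.
Hypothesis cG : continuous G.
Hypothesis GZ : forall a z, 0 <= a -> G (a *: z) = a * G z.
Hypothesis G_gt0 : forall z, z != 0 -> 0 < G z.

Lemma gauge0 : G 0 = 0.
Proof. by rewrite -(scale0r 0) GZ// mul0r. Qed.

Lemma gauge_ge0 z : 0 <= G z.
Proof. by have [->|/G_gt0/ltW//] := eqVneq z 0; rewrite gauge0. Qed.

Definition rad z : 'rV[R]_d := (G z / nrm2 z) *: z.
Definition unrad z : 'rV[R]_d := (nrm2 z / G z) *: z.

Lemma nrm2_rad z : nrm2 (rad z) = G z.
Proof.
have [->|z0] := eqVneq z 0.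
  by rewrite /rad scaler0 gauge0; apply/eqP; rewrite nrm2_eq0.
rewrite nrm2Z ?divr_ge0 ?nrm2_ge0 ?gauge_ge0// mulfVK//.
by rewrite nrm2_eq0.
Qed.

Lemma gauge_unrad z : G (unrad z) = nrm2 z.
Proof.
have [->|z0] := eqVneq z 0.
  by rewrite /unrad scaler0 gauge0; apply/eqP; rewrite eq_sym nrm2_eq0.
by rewrite GZ ?divr_ge0 ?nrm2_ge0 ?gauge_ge0// mulfVK// gt_eqF// G_gt0.
Qed.

Lemma radK : cancel rad unrad.
Proof.
move=> z; have [->|z0] := eqVneq z 0; first by rewrite /unrad /rad !scaler0.
have n0 := nrm2_eq0 z; rewrite (negbTE z0) in n0.
have g0 : G z != 0 by rewrite gt_eqF// G_gt0.
rewrite /unrad nrm2_rad /rad GZ ?divr_ge0 ?nrm2_ge0 ?gauge_ge0// scalerA.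
rewrite [X in X *: _](_ : _ = 1) ?scale1r//.
by field; rewrite g0 n0.
Qed.

Lemma unradK : cancel unrad rad.
Proof.
move=> z; have [->|z0] := eqVneq z 0; first by rewrite /unrad /rad !scaler0.
have n0 := nrm2_eq0 z; rewrite (negbTE z0) in n0.
have g0 : G z != 0 by rewrite gt_eqF// G_gt0.
rewrite /rad gauge_unrad /unrad nrm2Z ?divr_ge0 ?nrm2_ge0 ?gauge_ge0// scalerA.
rewrite [X in X *: _](_ : _ = 1) ?scale1r//.
by field; rewrite g0 n0.
Qed.

Lemma cont_on_rad : cont_on setT rad.
Proof.
apply: cont_on_row => i; apply: (@cont_on_origin _ _ G).
- apply: (@cont_on_ext _ _ _ (fun z => G z / nrm2 z * z ord0 i)).
    by move=> z _; rewrite mxE.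
  apply: cont_onM; last by apply: cont_onW; exact: coord_continuous.
  apply: cont_onM; first exact: cont_onW.
  apply: cont_onV => [z [_ z0]|]; first by rewrite nrm2_eq0.
  exact: cont_on_nrm2 (@cont_on_id _ _).
- move=> z _; rewrite -nrm2_rad; exact: coord_le_nrm2.
- exact: gauge0.
- exact: cont_onW.
Qed.

End EuclideanNorm.

(** * Minimum of coordinates over a set of vertices *)

Section MinOn.
Variables (R : realType) (V : finType).
Implicit Types (A : {set V}) (F : V -> R).

(** The order properties take [a \in A], which makes the starting value [F a] harmless and the
    result a true minimum. *)
Definition minon A (a : V) F : R := \big[Num.min/F a]_(p in A) F p.

Lemma minonP A a F : a \in A ->
  exists2 p, p \in A & minon A a F = F p /\ forall q, q \in A -> F p <= F q.
Proof.
move=> aA; case: (@Order.TotalTheory.arg_minP _ _ _ a (mem A) F aA) => p pA pm.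
exists p => //; split => //; apply: le_anti; apply/andP; split.
  exact: bigmin_le_cond.
by apply: le_bigmin => [|q qA]; exact: pm.
Qed.

Lemma minon_eq A a F p : a \in A -> p \in A ->
  (forall q, q \in A -> F p <= F q) -> minon A a F = F p.
Proof.
move=> aA pA pm; have [q qA [-> qm]] := minonP F aA.
by apply: le_anti; rewrite qm// pm.
Qed.

Lemma minon_le A a F q : a \in A -> q \in A -> minon A a F <= F q.
Proof. by move=> aA qA; have [p pA [->]] := minonP F aA; apply. Qed.

Lemma minon_ge A a F c : a \in A -> (forall q, q \in A -> c <= F q) -> c <= minon A a F.
Proof. by move=> aA H; have [p pA [-> _]] := minonP F aA; exact: H. Qed.

Lemma eq_minon A a F F' : a \in A -> {in A, F =1 F'} -> minon A a F = minon A a F'.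
Proof.
move=> aA FF'; have [p pA [-> pm]] := minonP F aA; rewrite FF'//.
by rewrite (@minon_eq _ _ _ p)// => q qA; rewrite -!FF'//; exact: pm.
Qed.

Lemma minonM A a F c : a \in A -> 0 <= c ->
  minon A a (fun p => c * F p) = c * minon A a F.
Proof.
move=> aA c0; have [p pA [-> pm]] := minonP F aA.
by rewrite (@minon_eq _ _ _ p)// => q qA; rewrite ler_wpM2l// pm.
Qed.

Lemma minonD A a F c : a \in A -> minon A a (fun p => F p + c) = minon A a F + c.
Proof.
move=> aA; have [p pA [-> pm]] := minonP F aA.
by rewrite (@minon_eq _ _ _ p)// => q qA; rewrite lerD2r pm.
Qed.

Lemma cont_on_minon (S : topologicalType) (B : set S) A a (F : S -> V -> R) :
  (forall p, cont_on B (F^~ p)) -> cont_on B (fun x => minon A a (F x)).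
Proof. by move=> cF; apply: cont_on_bigmin. Qed.

End MinOn.

(** * Barycentric coordinates indexed by vertices *)

Section Points.
Variables (R : realType) (V : finType).
Implicit Types (w : 'rV[R]_#|V|) (F : V -> R) (D : {set {set V}}) (C : {set V}).

Definition pt w (v : V) : R := w ord0 (enum_rank v).
Definition mkrow F : 'rV[R]_#|V| := \row_i F (enum_val i).

Lemma ptK F v : pt (mkrow F) v = F v.
Proof. by rewrite /pt mxE enum_rankK. Qed.

Lemma ptP w w' : pt w =1 pt w' -> w = w'.
Proof. by move=> ww'; apply/rowP => i; have := ww' (enum_val i);
  rewrite /pt enum_valK. Qed.

Lemma sum_pt w : \sum_i w ord0 i = \sum_v pt w v.
Proof.
rewrite (reindex (@enum_rank V))//=.
by exists enum_val => i _; [exact: enum_rankK|exact: enum_valK].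
Qed.

Lemma in_support w v : (v \in Defs.support w) = (pt w v != 0).
Proof. by rewrite inE. Qed.

Lemma realizationP D w : realization R D w <->
  [/\ forall v, 0 <= pt w v, \sum_v pt w v = 1 & Defs.support w \in D].
Proof.
rewrite /realization /= sum_pt; split=> -[w0 w1 wD]; split => // i.
  exact: w0.
by have := w0 (enum_val i); rewrite /pt enum_valK.
Qed.

Lemma cont_on_pt (S : topologicalType) (A : set S) (f : S -> 'rV[R]_#|V|) v :
  cont_on A f -> cont_on A (fun x => pt (f x) v).
Proof. exact: cont_on_coord. Qed.

Lemma cont_on_mkrow (S : topologicalType) (A : set S) (f : S -> V -> R) :
  (forall v, cont_on A (f^~ v)) -> cont_on A (fun x => mkrow (f x)).
Proof.
move=> cf; apply: cont_on_row => i.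
by apply: cont_on_ext (cf (enum_val i)) => x _; rewrite mxE.
Qed.

Lemma pt_le1 D w v : realization R D w -> pt w v <= 1.
Proof.
move=> /realizationP[w0 <- _]; rewrite (bigD1 v)//= lerDl.
by apply: sumr_ge0 => u _; exact: w0.
Qed.

(** Inside a cube the support condition is closed: for a complex it is the finite union, over the
    faces C, of the conditions that w vanish outside C. *)
Lemma realization_compact D : simplicial_complex D -> compact (realization R D).
Proof.
move=> scD.
have cube : compact [set w : 'rV[R]_#|V| | forall i, `[0, 1]%classic (w ord0 i)].
  apply: (@rV_compact R _ (fun=> `[0, 1]%classic)) => i; exact: segment_compact.
have cpt v : continuous (pt ^~ v : 'rV[R]_#|V| -> R) by exact: coord_continuous.
apply: (subclosed_compact _ cube).
  have -> : realization R D = \bigcap_(v in [set: V]) [set w | 0 <= pt w v] `&`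
     [set w | \sum_v pt w v = 1] `&`
     \bigcup_(C in [set` [set C in D]]) \bigcap_(v in [set` ~: C]) [set w | pt w v = 0].
    apply/seteqP; split => [w /realizationP[w0 w1 wD]|w [[w0 w1] [C CD wC]]].
      split; first by split => //= v _; exact: w0.
      exists (Defs.support w) => [|v]; rewrite /= inE// in_support negbK => /eqP//.
    apply/realizationP; split => [v||] //; first exact: w0.
    rewrite /= inE in CD; apply: (scD _ _ CD); apply/fintype.subsetP => v.
    rewrite in_support; apply: contraNT => vC; apply/eqP; apply: wC.
    by rewrite /= inE.
  apply: closedI; first apply: closedI.
  - apply: closed_bigI => v _.
    exact: ((continuous_closedP _).1 (cpt v) _ (@closed_ge _ 0)).
  - have csum : continuous (fun w : 'rV[R]_#|V| => \sum_v pt w v).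
      by apply: cont_onT; apply: cont_on_sum => v _; exact: cont_onW.
    exact: ((continuous_closedP _).1 csum _ (@closed_eq _ 1)).
  - apply: closed_bigcup => [|C _]; first exact: finite_finset.
    apply: closed_bigI => v _.
    exact: ((continuous_closedP _).1 (cpt v) _ (@closed_eq _ 0)).
move=> w Dw i; rewrite /= in_itv/=; apply/andP; split.
  by case: Dw.
by have := pt_le1 (enum_val i) Dw; rewrite /pt enum_valK.
Qed.

Lemma realization_closed D : simplicial_complex D -> closed (realization R D).
Proof.
by move=> scD; apply: compact_closed;
  [exact: norm_hausdorff|exact: realization_compact].
Qed.

End Points.

(** The boundary is part of the data because the next facet is glued along a piece of it. *)
Definition ball_pair (R : realType) (d n : nat) (M B : set 'rV[R]_n) : Prop :=
  exists f g, homeomorphism M (euclidean_ball R d) f g /\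
    forall x, M x -> (B x <-> euclidean_sphere R d (f x)).
Arguments ball_pair {R} d {n} M B.

Lemma rV_hausdorff (R : realType) n : hausdorff_space 'rV[R]_n.
Proof. exact: norm_hausdorff. Qed.

(** Compactness supplies the continuity of the inverse g, which may therefore be given by cases. *)
Lemma ball_pair_compact (R : realType) d n (M B : set 'rV[R]_n)
    (f : 'rV[R]_n -> 'rV[R]_d) (g : 'rV[R]_d -> 'rV[R]_n) :
  compact M -> cont_on M f ->
  (forall x, M x -> nrm2 (f x) <= 1 /\ g (f x) = x) ->
  (forall z, nrm2 z <= 1 -> M (g z) /\ f (g z) = z) ->
  (forall x, M x -> (B x <-> nrm2 (f x) = 1)) ->
  ball_pair d M B.
Proof.
move=> cM cf fM gD fB; exists f, g; split.
  apply: compact_homeomorphism => //; try exact: rV_hausdorff.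
    by move=> x /fM[? ?]; split => //; apply/ballE.
  by move=> z /ballE /gD.
by move=> x Mx; rewrite fB//; split => ?; apply/sphereE.
Qed.

(** * A gauge on functions modulo constants on blocks *)

Section BlockGauge.
Variables (R : realType) (V I : finType) (S : {set V}) (blk : V -> I) (o : I -> V).
Hypothesis oS : forall i, o i \in S.
Hypothesis oblk : forall i, blk (o i) = i.

(** Indexes coordinates on the space of functions on S modulo constants on each block: a class is
    represented by its member vanishing at the base vertices. *)
Definition nonbase : {set V} := finset (fun p => (p \in S) && (p != o (blk p))).

Definition block i : {set V} := finset (fun p => (p \in S) && (blk p == i)).

Lemma block_o i : o i \in block i.
Proof. by rewrite inE oS oblk eqxx. Qed.

Lemma mem_block p : p \in S -> p \in block (blk p).
Proof. by move=> pS; rewrite inE pS eqxx. Qed.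

Implicit Types (u : 'rV[R]_#|nonbase|) (w : 'rV[R]_#|V|).

Definition ext u (p : V) : R := \sum_(i | enum_val i == p) u ord0 i.

Lemma ext_val u i : ext u (enum_val i) = u ord0 i.
Proof.
by rewrite /ext (big_pred1 i)// => j; rewrite /= (inj_eq enum_val_inj).
Qed.

Lemma ext_out u p : p \notin nonbase -> ext u p = 0.
Proof.
move=> pN; rewrite /ext big_pred0// => i; apply: contraNF pN => /eqP <-.
exact: enum_valP.
Qed.

Lemma ext_o u i : ext u (o i) = 0.
Proof. by apply: ext_out; rewrite inE oblk eqxx andbF. Qed.

Lemma extZ a u p : ext (a *: u) p = a * ext u p.
Proof. by rewrite /ext mulr_sumr; apply: eq_bigr => i _; rewrite mxE. Qed.

Lemma ext_inj u u' : {in S, ext u =1 ext u'} -> u = u'.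
Proof.
move=> uu'; apply/rowP => i; rewrite -!ext_val; apply: uu'.
by have := enum_valP i; rewrite inE => /andP[].
Qed.

Definition blockmin u i := minon (block i) (o i) (ext u).
(** The total mass of the member of the class whose minimum on every block is 0. *)
Definition gauge u : R := \sum_(p in S) (ext u p - blockmin u (blk p)).

Lemma blockminZ a u i : 0 <= a -> blockmin (a *: u) i = a * blockmin u i.
Proof.
move=> a0; rewrite /blockmin -minonM ?block_o//.
by apply: eq_minon; rewrite ?block_o// => p _; exact: extZ.
Qed.

Lemma gaugeZ a u : 0 <= a -> gauge (a *: u) = a * gauge u.
Proof.
move=> a0; rewrite mulr_sumr; apply: eq_bigr => p _.
by rewrite blockminZ// extZ mulrBr.
Qed.

Lemma blockmin_le u p : p \in S -> blockmin u (blk p) <= ext u p.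
Proof. by move=> pS; apply: minon_le; rewrite ?block_o ?mem_block. Qed.

(** All terms are nonnegative. If they vanish, [ext u] is constant on each block, with the value 0
    of its base vertex. *)
Lemma gauge_gt0 u : u != 0 -> 0 < gauge u.
Proof.
move=> u0; have ge0 p : p \in S -> 0 <= ext u p - blockmin u (blk p).
  by move=> pS; rewrite subr_ge0 blockmin_le.
rewrite lt0r (sumr_ge0 _ ge0) andbT; apply: contra u0 => /eqP s0.
have e p : p \in S -> ext u p = blockmin u (blk p).
  by move=> pS; apply/eqP; rewrite -subr_eq0 (psumr_eq0P ge0 s0).
apply/eqP; apply: ext_inj => p pS.
rewrite e// -(oblk (blk p)) -e// ext_o.
by rewrite /ext big1// => i _; rewrite mxE.
Qed.

Lemma cont_ext p : continuous (ext ^~ p).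
Proof.
apply: cont_onT; apply: cont_on_sum => i _; apply: cont_onW.
exact: coord_continuous.
Qed.

Lemma cont_blockmin i : continuous (blockmin ^~ i).
Proof. by apply: cont_onT; apply: cont_on_minon => p; apply: cont_onW;
  exact: cont_ext. Qed.

Lemma cont_gauge : continuous gauge.
Proof.
apply: cont_onT; apply: cont_on_sum => p _.
by apply: cont_onB; apply: cont_onW; [exact: cont_ext|exact: cont_blockmin].
Qed.

Definition differences w : 'rV[R]_#|nonbase| :=
  \row_i (pt w (enum_val i) - pt w (o (blk (enum_val i)))).

Lemma ext_differences w p : p \in S ->
  ext (differences w) p = pt w p - pt w (o (blk p)).
Proof.
move=> pS; have [pN|pN] := boolP (p \in nonbase); last first.
  rewrite ext_out//; move: pN; rewrite inE pS/= negbK => /eqP <-.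
  by rewrite subrr.
by rewrite -(enum_rankK_in pN pN) ext_val mxE enum_rankK_in.
Qed.

Lemma blockmin_differences w i :
  blockmin (differences w) i = minon (block i) (o i) (pt w) - pt w (o i).
Proof.
rewrite /blockmin -minonD ?block_o//; apply: eq_minon; rewrite ?block_o// => p.
by rewrite inE => /andP[pS /eqP <-]; exact: ext_differences.
Qed.

Lemma gauge_differences w : gauge (differences w) =
  \sum_(p in S) (pt w p - minon (block (blk p)) (o (blk p)) (pt w)).
Proof.
apply: eq_bigr => p pS; rewrite ext_differences// blockmin_differences.
by rewrite opprB addrA subrK.
Qed.

Lemma cont_differences (A : set 'rV[R]_#|V|) : cont_on A differences.
Proof.
apply: cont_on_row => i.
apply: (@cont_on_ext _ _ A (fun w => pt w (enum_val i) - pt w (o (blk (enum_val i))))).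
  by move=> w _; rewrite mxE.
by apply: cont_onB; apply: cont_on_pt; exact: cont_on_id.
Qed.

Lemma cont_rad_differences (A : set 'rV[R]_#|V|) :
  cont_on A (fun w => rad gauge (differences w)).
Proof.
apply: (@cont_on_comp _ _ _ A setT) => //; first exact: cont_differences.
exact: (cont_on_rad cont_gauge gaugeZ gauge_gt0).
Qed.

End BlockGauge.

(** * A simplex as a ball *)

Section Simplex.
Variables (R : realType) (V : finType) (S : {set V}) (s0 : V).
Hypothesis s0S : s0 \in S.

Let blk (_ : V) := tt.
Let o (_ : unit) := s0.
Let oS i : o i \in S. Proof. exact: s0S. Qed.
Let oblk i : blk (o i) = i. Proof. by case: i. Qed.

Let J := nonbase S blk o.
Let G : 'rV[R]_#|J| -> R := @gauge R V unit S blk o.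
Let mS (w : 'rV[R]_#|V|) := minon S s0 (pt w).

Let blockS i : block S blk i = S.
Proof. by apply/setP => p; rewrite inE andbT. Qed.

Let GE w : \sum_v pt w v = 1 -> (forall v, v \notin S -> pt w v = 0) ->
  G (differences S blk o w) = 1 - #|S|%:R * mS w.
Proof.
move=> w1 wS; rewrite /G (gauge_differences oS oblk).
rewrite sumrB; congr (_ - _); last first.
  by rewrite mulr_natl -sumr_const; apply: eq_bigr => p _; rewrite blockS.
rewrite -w1 [RHS](bigID (mem S))/= [X in _ + X]big1 ?addr0// => v; exact: wS.
Qed.

(** Normalises the class to minimum 0 and spreads the missing mass [1 - G u] evenly over S. *)
Let back (z : 'rV[R]_#|J|) : 'rV[R]_#|V| :=
  let u := unrad G z in
  mkrow (fun p => if p \in S then ext u p - @blockmin R V unit S blk o u tt + (1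
    - G u) / #|S|%:R else 0).

(** With the single block S, the class of w has gauge 1 - |S| m, where m is the least coordinate
    over S. The class thus determines w, the barycentre goes to 0, and the boundary, where m = 0,
    goes to the unit sphere. *)
Lemma simplex_ball_pair :
  exists d, ball_pair d (realization R (powerset S))
    (realization R (powerset S :\ S)%SET).
Proof.
have S0 : 0 < #|S|%:R :> R by rewrite ltr0n; apply/card_gt0P; exists s0.
have S0' : #|S|%:R != 0 :> R by rewrite gt_eqF.
have GZ := @gaugeZ R V unit S blk o oS oblk.
have G0 := @gauge_gt0 R V unit S blk o oS oblk.
exists #|J|; pose f w := rad G (differences S blk o w).
have inS w : realization R (powerset S) w -> forall v, v \notin S -> pt w v = 0.
  move=> /realizationP[_ _]; rewrite powersetE => /fintype.subsetP wS v.
  by apply: contraNeq => v0; apply: wS; rewrite in_support.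
have scS : simplicial_complex (powerset S).
  by move=> A B; rewrite !powersetE => AS BA; exact: fintype.subset_trans AS.
have nf w : realization R (powerset S) w -> nrm2 (f w) = 1 - #|S|%:R * mS w.
  move=> Sw; have [w0 w1 _] := (realizationP _ _).1 Sw.
  by rewrite /f nrm2_rad// GE//; exact: inS.
apply: (@ball_pair_compact _ _ _ _ _ f back).
- exact: realization_compact.
- exact: cont_rad_differences.
- move=> w Sw; have [w0 w1 _] := (realizationP _ _).1 Sw; split.
    by rewrite nf// gerBl mulr_ge0//; apply: minon_ge.
  apply: ptP => p; rewrite /back ptK radK//.
  case: ifPn => pS; last by rewrite (inS w Sw).
  rewrite ext_differences// (blockmin_differences oS oblk) blockS.
  rewrite (GE w1 (inS _ Sw)) -/(mS w) /o; by field.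
- move=> z z1; set u := unrad G z.
  have Gu : G u = nrm2 z by exact: gauge_unrad.
  pose m := @blockmin R V unit S blk o u tt.
  have ptb p : pt (back z) p = if p \in S then ext u p - m + (1 - G u) / #|S|%:R else 0.
    by rewrite ptK.
  have Sb : realization R (powerset S) (back z).
    apply/realizationP; split.
    + move=> p; rewrite ptb; case: ifP => // pS; apply: addr_ge0.
        by rewrite subr_ge0 (blockmin_le oS oblk).
      by rewrite divr_ge0 ?ler0n// Gu subr_ge0.
    + rewrite (bigID (mem S))/= [X in _ + X]big1 ?addr0; last first.
        by move=> p /negbTE pS; rewrite ptb pS.
      under eq_bigr => p pS do rewrite ptb pS.
      rewrite big_split/= sumr_const -[X in _ + X]mulr_natr divfK//.
      rewrite [X in X + _](_ : _ = G u); first by rewrite addrC subrK.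
      by apply: eq_bigr => p _.
    + rewrite powersetE; apply/fintype.subsetP => p; rewrite in_support ptb.
      by case: ifP => //; rewrite eqxx.
  split=> //; rewrite /f.
  have -> : differences S blk o (back z) = u.
    apply: ext_inj => p pS; rewrite ext_differences// !ptb pS s0S.
    have := @ext_o R V unit S blk o oblk u tt; rewrite /o => ->; ring.
  exact: unradK.
- move=> w Sw; rewrite nf//; have [w0 w1 wS] := (realizationP _ _).1 Sw.
  have [p pS [mp pm]] := minonP (pt w) s0S.
  split=> [/realizationP[_ _]|].
    rewrite !inE => /andP[wnS _]; rewrite /mS mp.
    suff -> : pt w p = 0 by rewrite mulr0 subr0.
    apply: contraNeq wnS => p0; rewrite finset.eqEsubset -powersetE wS/=.
    apply/fintype.subsetP => q qS; rewrite in_support gt_eqF//.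
    by rewrite (lt_le_trans _ (pm q qS))// lt0r p0 w0.
  move=> H; have {H} : #|S|%:R * mS w = 0 by lra.
  move=> /eqP; rewrite mulf_eq0 (negbTE S0')/= /mS mp => /eqP p0.
  apply/realizationP; split => //; rewrite !inE -powersetE wS andbT.
  by apply: contraTneq pS => <-; rewrite in_support p0 eqxx.
Qed.

End Simplex.

(** * A join of boundaries of simplices as a sphere *)

Section Sphere.
Variables (R : realType) (V I : finType) (S : {set V}) (blk : V -> I) (o : I -> V).
Hypothesis oS : forall i, o i \in S.
Hypothesis oblk : forall i, blk (o i) = i.
Variable D : {set {set V}}.
Hypothesis DP : forall C : {set V}, reflect
  ((C \subset S) /\ forall i, exists2 p, p \in S :\: C & blk p = i) (C \in D).

Let J := nonbase S blk o.
Let G : 'rV[R]_#|J| -> R := @gauge R V I S blk o.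
Let back (z : 'rV[R]_#|J|) : 'rV[R]_#|V| :=
  let u := unrad G z in
  mkrow (fun p => if p \in S then ext u p - @blockmin R V I S blk o u (blk p) else 0).

(** A face omits a vertex of each block, so every block minimum of w is 0 and w is the member of its
    class measured by [gauge], of mass 1. Conversely the vertices where block minima are attained
    stay outside the support. *)
Lemma block_join_sphere :
  exists d, homeomorphic (realization R D) (euclidean_sphere R d).
Proof.
have GZ := @gaugeZ R V I S blk o oS oblk.
have G0 := @gauge_gt0 R V I S blk o oS oblk.
exists #|J|; pose f w := rad G (differences S blk o w).
have scD : simplicial_complex D.
  move=> A B /DP[AS AI] BA; apply/DP; split; first exact: fintype.subset_trans AS.
  move=> i; have [p pA pi] := AI i; exists p => //; move: pA; rewrite !inE.
  by move=> /andP[pA ->]; rewrite andbT; apply: contra pA; exact: (fintype.subsetP BA).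
have inS w : realization R D w -> forall v, v \notin S -> pt w v = 0.
  move=> /realizationP[_ _ /DP[/fintype.subsetP wS _]] v.
  by apply: contraNeq => v0; apply: wS; rewrite in_support.
have m0 w i : realization R D w -> minon (block S blk i) (o i) (pt w) = 0.
  move=> /realizationP[w0 _ /DP[_ /(_ i)[p]]].
  rewrite !inE negbK => /andP[/eqP p0 pS] pi.
  have p0' : pt w p = 0 by [].
  have pb : p \in block S blk i by rewrite inE pS pi eqxx.
  have pm q : q \in block S blk i -> pt w p <= pt w q by rewrite p0'.
  by rewrite (minon_eq (block_o oS oblk i) pb pm).
exists f, back; apply: compact_homeomorphism; try exact: rV_hausdorff.
- exact: realization_compact.
- exact: cont_rad_differences.
- move=> w Dw; have [w0 w1 _] := (realizationP _ _).1 Dw; split.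
    apply/sphereE; rewrite nrm2_rad// /G (gauge_differences oS oblk) -w1.
    rewrite [RHS](bigID (mem S))/= [X in _ = _ + X]big1 ?addr0//;
      last by move=> v; exact: inS.
    by apply: eq_bigr => p _; rewrite m0// subr0.
  apply: ptP => p; rewrite /back ptK radK//.
  case: ifPn => pS; last by rewrite (inS w Dw).
  rewrite ext_differences// (blockmin_differences oS oblk) m0//.
  by ring.
- move=> z /sphereE z1; set u := unrad G z.
  have Gu : G u = 1 by rewrite gauge_unrad.
  have ptb p :
    pt (back z) p = if p \in S then ext u p - @blockmin R V I S blk o u (blk p) else 0.
    by rewrite ptK.
  have Db : realization R D (back z).
    apply/realizationP; split.
    + move=> p; rewrite ptb; case: ifP => // pS.
      by rewrite subr_ge0 (blockmin_le oS oblk).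
    + rewrite (bigID (mem S))/= [X in _ + X]big1 ?addr0; last first.
        by move=> p /negbTE pS; rewrite ptb pS.
      by rewrite -Gu; apply: eq_bigr => p pS; rewrite ptb pS.
    + apply/DP; split.
        apply/fintype.subsetP => p; rewrite in_support ptb.
        by case: ifP => //; rewrite eqxx.
      move=> i; have [p pi [mp _]] := minonP (ext u) (block_o oS oblk i).
      move: pi; rewrite inE => /andP[pS /eqP pi]; exists p => //.
      by rewrite !inE pS andbT negbK -[w in w == 0]/(pt (back z) p) ptb pS pi
        /blockmin mp subrr.
  split=> //; rewrite /f.
  have -> : differences S blk o (back z) = u.
    apply: ext_inj => p pS; rewrite ext_differences// !ptb pS oS.
    by rewrite (ext_o oblk) oblk; ring.
  exact: unradK.
Qed.

End Sphere.

(** * Attaching a facet to a ball *)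

(** Turns containment of A or G in a support into the sign of a continuous function. *)
Lemma minon_support (R : realType) (V : finType) (A : {set V}) a (w : 'rV[R]_#|V|) :
  a \in A -> (forall v, 0 <= pt w v) ->
  (A \subset Defs.support w) = (0 < minon A a (pt w)).
Proof.
move=> aA w0; have [p pA [-> pm]] := minonP (pt w) aA; apply/idP/idP.
  by move=> /fintype.subsetP/(_ p pA); rewrite in_support lt0r w0 andbT.
move=> p0; apply/fintype.subsetP => q qA; rewrite in_support gt_eqF//.
exact: lt_le_trans (pm q qA).
Qed.

Section Attach.
Variables (R : realType) (V : finType) (d : nat).
Variables (D Bd Bd' : {set {set V}}) (S A G : {set V}) (a g0 : V).
Hypothesis scD : simplicial_complex D.
Hypotheses (aA : a \in A) (gG : g0 \in G).
Hypotheses (AS : A \subset S) (GE : G = (S :\: A)%SET).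
Hypothesis DS : forall C : {set V}, C \subset S -> (C \in D) = ~~ (A \subset C).
Hypothesis BdS : forall C : {set V}, C \subset S -> C \in D -> C \in Bd.
Hypothesis BdD : {subset Bd <= D}.
Hypothesis BdG : forall C : {set V}, C \in Bd -> G \subset C -> C \subset S.
Hypothesis Bd'E : forall C : {set V}, (C \in Bd') =
  [&& (C \in D) || (C \subset S), ~~ (G \subset C) & (C \in Bd) || (C \subset S)].
Hypothesis ballD : ball_pair d (realization R D) (realization R Bd).

Let D' : {set {set V}} := (D :|: powerset S)%SET.
Let M := realization R D.
Let F := realization R (powerset S).
Implicit Types (w b : 'rV[R]_#|V|) (z : 'rV[R]_d).

Let scS : simplicial_complex (powerset S).
Proof. by move=> C B; rewrite !powersetE => CS BC; exact: fintype.subset_trans CS. Qed.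

Let scD' : simplicial_complex D'.
Proof.
by move=> C B; rewrite !inE => /orP[/scD H /H->//|CS BC];
  rewrite (fintype.subset_trans BC CS) orbT.
Qed.

Let mA w := minon A a (pt w).
Let mG w := minon G g0 (pt w).
(** Vertices of G lose s each while those of A gain s / c each; this ratio makes the two totals
    cancel. *)
Let c : R := #|A|%:R / #|G|%:R.

Let A0 : 0 < #|A|%:R :> R.
Proof. by rewrite ltr0n; apply/card_gt0P; exists a. Qed.
Let G0 : 0 < #|G|%:R :> R.
Proof. by rewrite ltr0n; apply/card_gt0P; exists g0. Qed.
Let c0 : 0 < c. Proof. exact: divr_gt0. Qed.

Let AG v : v \in A -> (v \in G) = false.
Proof. by move=> vA; rewrite GE inE vA. Qed.
Let GA v : v \in G -> (v \in A) = false.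
Proof. by rewrite GE inE => /andP[/negbTE]. Qed.
Let GS v : v \in G -> v \in S.
Proof. by rewrite GE inE => /andP[]. Qed.

(* Moves along the direction that raises the coordinates in A and lowers those
   in G, preserving the total mass. *)
Let slide w (s : R) : 'rV[R]_#|V| :=
  mkrow (fun v => pt w v + s / c * (v \in A)%:R - s * (v \in G)%:R).

Let slide_slide w s t : slide (slide w s) t = slide w (s + t).
Proof. by apply: ptP => v; rewrite !ptK; field; rewrite gt_eqF. Qed.

Let slide0 w : slide w 0 = w.
Proof. by apply: ptP => v; rewrite ptK; ring. Qed.

Let sum_slide w s : \sum_v pt (slide w s) v = \sum_v pt w v.
Proof.
under eq_bigr do rewrite ptK.
rewrite !big_split/= sumrN -!mulr_sumr -!natr_sum.
have card (B : {set V}) : (\sum_v (v \in B : nat) = #|B|)%N.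
  by rewrite -sum1_card [RHS]big_mkcond; apply: eq_bigr => v _; case: (v \in B).
rewrite !card /c; field.
by rewrite gt_eqF// gt_eqF.
Qed.

Let mA_slide w s : mA (slide w s) = mA w + s / c.
Proof.
rewrite /mA -minonD//; apply: eq_minon => // v vA.
by rewrite ptK vA AG// mulr1 mulr0 subr0.
Qed.

Let mG_slide w s : mG (slide w s) = mG w - s.
Proof.
rewrite /mG -minonD//; apply: eq_minon => // v vG.
by rewrite ptK vG GA// mulr1 mulr0 addr0.
Qed.

Let slideF w s : F w -> 0 <= mA w + s / c -> s <= mG w -> F (slide w s).
Proof.
move=> /realizationP[w0 w1 wS] sA sG; apply/realizationP; split.
- move=> v; rewrite ptK.
  have [vA|vA] := boolP (v \in A).
    rewrite AG// mulr0 subr0 mulr1; apply: le_trans sA _.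
    by rewrite lerD2r; exact: minon_le.
  have [vG|vG] := boolP (v \in G); last by rewrite !mulr0 subr0 addr0.
  rewrite mulr0 addr0 mulr1 subr_ge0; apply: le_trans sG _.
  exact: minon_le.
- by rewrite sum_slide.
- rewrite powersetE in wS; rewrite powersetE; apply/fintype.subsetP => v.
  rewrite in_support; apply: contraNT => vS; rewrite ptK.
  have -> : v \in A = false by apply: contraNF vS; exact: (fintype.subsetP AS).
  have -> : v \in G = false by apply: contraNF vS; exact: GS.
  have -> : pt w v = 0.
    apply/eqP; apply: contraNT vS => v0; apply: (fintype.subsetP wS).
    by rewrite in_support.
  by rewrite !mulr0 addr0 subr0.
Qed.

(** A point w of the new facet is the point [proj w] of the old boundary slid by [t w], which ranges
    from 0 to [mG (proj w)]. In the coordinates of [phi] the union is thus a star-shaped region of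
    radius 1 + k, with k the value of [mG] at the boundary point in each direction, and [psi]
    rescales it to radius 1. *)
Lemma attach_ball_pair : ball_pair d (realization R D') (realization R Bd').
Proof.
have [phi [g [[/cont_onP cphi /cont_onP cg phiD gD] phiB]]] := ballD.
have FM w : M w -> F w -> mA w = 0 /\ realization R Bd w.
  move=> /realizationP[w0 w1 wD] /realizationP[_ _]; rewrite powersetE => wS; split.
    apply/eqP; have := DS wS; rewrite wD (minon_support aA w0) lt0r negb_and.
    move=> /esym/orP[|/negP[]]; first by rewrite negbK.
    exact: minon_ge.
  by apply/realizationP; split => //; exact: BdS.
have mG_ge0 w : (forall v, 0 <= pt w v) -> 0 <= mG w by move=> w0; exact: minon_ge.
have mA_ge0 w : (forall v, 0 <= pt w v) -> 0 <= mA w by move=> w0; exact: minon_ge.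
(* Where [mG] is positive on the old boundary, [BdG] places the point in the new facet, so the
   region is stretched only over the attached part. *)
have unitP z : nrm2 z = 1 ->
    [/\ M (g z), phi (g z) = z, 0 <= mG (g z) <= 1 &
        0 < mG (g z) -> F (g z) /\ mA (g z) = 0].
  move=> z1; have [Mg pg] : M (g z) /\ phi (g z) = z by apply: gD; apply/ballE;
    rewrite z1.
  have Bg : realization R Bd (g z) by apply/phiB => //; rewrite pg; apply/sphereE.
  have [w0 w1 wB] := (realizationP _ _).1 Bg.
  split=> //.
    rewrite mG_ge0//=; apply: (le_trans (minon_le _ gG gG)).
    exact: pt_le1 Mg.
  rewrite -minon_support// => Gw.
  have Fg : F (g z) by apply/realizationP; split => //; rewrite powersetE; exact: BdG.
  by split => //; have [] := FM _ Mg Fg.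
pose unit z := (nrm2 z)^-1 *: z.
have unitE z : z != 0 -> nrm2 (unit z) = 1 by exact: nrm2_unit.
have unitZ q z : 0 < q -> unit (q *: z) = unit z.
  move=> q0; have [->|z0] := eqVneq z 0; first by rewrite scaler0.
  rewrite /unit nrm2Z ?ltW// scalerA; congr (_ *: _); field.
  by rewrite nrm2_eq0 z0 gt_eqF.
have unit1 z : nrm2 z = 1 -> unit z = z by rewrite /unit => ->; rewrite invr1 scale1r.
have nu z : nrm2 z *: unit z = z.
  have [->|z0] := eqVneq z 0; first by rewrite /unit !scaler0.
  by rewrite scalerA mulfV ?scale1r ?nrm2_eq0.
have cunit : cont_on (euclidean_ball R d `&` [set z | z != 0]) unit.
  apply: cont_onZ; last exact: cont_on_id.
  apply: cont_onV => [z [_ z0]|]; first by rewrite nrm2_eq0.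
  by apply: cont_on_nrm2; exact: cont_on_id.
pose k z := mG (g (unit z)).
have k01 z : z != 0 -> 0 <= k z <= 1 by move=> z0; case: (unitP _ (unitE z z0)).
(* The function k need not have a limit at the origin; the factor [nrm2 z] makes K continuous there
   and agrees with k on the sphere. *)
pose K z := nrm2 z * k z.
have K0 : K 0 = 0.
  by have /eqP := nrm2_eq0 (0 : 'rV[R]_d); rewrite eqxx => /eqP H;
    rewrite /K (eqP H) mul0r.
have K_ge0 z : 0 <= K z.
  have [->|/k01/andP[k0 _]] := eqVneq z 0; first by rewrite K0.
  by rewrite mulr_ge0 ?nrm2_ge0.
have cK : cont_on (euclidean_ball R d) K.
  apply: (@cont_on_origin _ _ _ _ (@nrm2 R d)).
  - apply: cont_onM; first by apply: cont_on_nrm2; exact: cont_on_id.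
    apply: cont_on_minon => v; apply: cont_on_pt.
    apply: (@cont_on_comp _ _ _ _ (euclidean_ball R d)) cunit cg => z [_ z0].
    by apply/ballE; rewrite unitE.
  - move=> z _; have [->|/k01/andP[k0 k1]] := eqVneq z 0.
      by rewrite K0 normr0 nrm2_ge0.
    by rewrite ger0_norm ?K_ge0// ler_piMr ?nrm2_ge0.
  - by apply/eqP; rewrite nrm2_eq0.
  - by apply: cont_on_nrm2; exact: cont_on_id.
pose t w := c * mA w.
pose proj w := slide w (- t w).
(* Radius 1 + t over 1 + k, because [mG (proj w)] equals [mG w + t w]. *)
pose psiF w := ((1 + t w) / (1 + t w + mG w)) *: phi (proj w).
pose psiM w := (1 + K (phi w))^-1 *: phi w.
pose psi w := if Defs.support w \subset S then psiF w else psiM w.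
have projP w : F w -> [/\ F (proj w), M (proj w), nrm2 (phi (proj w)) = 1,
    mG (proj w) = mG w + t w & 0 <= t w /\ 0 <= mG w].
  move=> Fw; have [w0 w1 wS] := (realizationP _ _).1 Fw.
  have t0 : 0 <= t w by rewrite mulr_ge0 ?mA_ge0// ltW.
  have mA0 : mA w + - t w / c = 0 by rewrite /t; field; rewrite gt_eqF.
  have Fp : F (proj w).
    apply: slideF => //; first by rewrite mA0.
    by rewrite (le_trans (y := 0)) ?oppr_le0// mG_ge0.
  have [p0 p1 pS] := (realizationP _ _).1 Fp; rewrite powersetE in pS.
  have pD : Defs.support (proj w) \in D.
    by rewrite DS// (minon_support aA)// -/(mA _) mA_slide mA0 ltxx.
  have Mp : M (proj w) by apply/realizationP; split.
  split=> //; last by split => //; exact: mG_ge0.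
    apply/sphereE/phiB => //; by case: (FM _ Mp Fp).
  by rewrite mG_slide opprK.
have proj_id w : M w -> F w -> proj w = w.
  by move=> Mw Fw; rewrite /proj /t (FM _ Mw Fw).1 mulr0 oppr0 slide0.
have psiFE w : F w -> psi w = psiF w.
  by move=> /realizationP[_ _]; rewrite powersetE /psi => ->.
(* On the overlap [mA] vanishes, so t = 0, and [phi w] has norm 1: both formulas divide by 1 + k. *)
have psiME w : M w -> psi w = psiM w.
  move=> Mw; rewrite /psi; case: ifP => // wS.
  have Fw : F w.
    by have [w0 w1 _] := (realizationP _ _).1 Mw; apply/realizationP; split;
      rewrite ?powersetE.
  have [_ _ n1 _ _] := projP _ Fw; rewrite proj_id// in n1.
  rewrite /psiF /psiM proj_id// /t (FM _ Mw Fw).1 mulr0 addr0 /K n1 !mul1r /k unit1//.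
  by rewrite (phiD w Mw).2.
have MFE : realization R D' = M `|` F.
  apply/seteqP; split => w.
    move=> /realizationP[w0 w1]; rewrite inE => /orP[wD|wS]; [left|right];
    exact/realizationP.
  by move=> -[] /realizationP[w0 w1 wD]; apply/realizationP; split => //;
    rewrite inE wD ?orbT.
(* Inverts the radial profile: q = r / (1 + r k) gives r = q / (1 - q k) in the old ball, and q = (1
   + t) / (1 + k) gives the slide t beyond it. The two meet at q (1 + k) = 1. *)
pose xi z := if z == 0 then g 0 else
  let q := nrm2 z in
  if q * (1 + k z) <= 1 then g ((q / (1 - q * k z)) *: unit z)
  else slide (g (unit z)) (q * (1 + k z) - 1).
have n0 : nrm2 (0 : 'rV[R]_d) = 0 by apply/eqP; rewrite nrm2_eq0.
have nM w : M w -> nrm2 (phi w) <= 1 by move=> Mw; apply/ballE; exact: (phiD w Mw).1.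
have npsiM w : M w -> nrm2 (psi w) = nrm2 (phi w) / (1 + K (phi w)).
  move=> Mw; rewrite psiME// /psiM nrm2Z 1?mulrC// invr_ge0.
  by rewrite addr_ge0.
have npsiF w : F w -> nrm2 (psi w) = (1 + t w) / (1 + t w + mG w).
  move=> Fw; have [_ _ n1 _ [t0 m0]] := projP _ Fw.
  by rewrite psiFE// /psiF nrm2Z ?n1 ?mulr1// divr_ge0// !addr_ge0.
apply: (@ball_pair_compact _ _ _ _ _ psi xi).
- exact: realization_compact.
- rewrite MFE; apply: cont_onU; try exact: realization_closed.
    apply: (@cont_on_ext _ _ _ psiM) => [w /set_mem Mw|]; first by rewrite psiME.
    apply: cont_onZ => //; apply: cont_onV => [w _|].
      by rewrite gt_eqF// (lt_le_trans ltr01)// lerDl.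
    apply: cont_onD; first exact: cont_on_cst.
    by apply: cont_on_comp cphi cK => w Mw; exact: (phiD w Mw).1.
  apply: (@cont_on_ext _ _ _ psiF) => [w /set_mem Fw|]; first by rewrite psiFE.
  have cpt v : cont_on F (fun w => pt w v) by apply: cont_on_pt; exact: cont_on_id.
  have cmA : cont_on F mA by exact: cont_on_minon.
  have cmG : cont_on F mG by exact: cont_on_minon.
  have ct : cont_on F t by apply: cont_onM => //; exact: cont_on_cst.
  have c1t : cont_on F (fun w => 1 + t w) by apply: cont_onD => //; exact: cont_on_cst.
  apply: cont_onZ.
    apply: cont_onM => //; apply: cont_onV; last exact: cont_onD.
    move=> w /projP[_ _ _ _ [t0 m0]]; rewrite gt_eqF//.
    by rewrite -addrA (lt_le_trans ltr01)// lerDl addr_ge0.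
  apply: (@cont_on_comp _ _ _ _ M) _ cphi; first by move=> w /projP[].
  apply: cont_on_mkrow => v; apply: cont_onB.
    apply: cont_onD => //; apply: cont_onM; last exact: cont_on_cst.
    by apply: cont_onM; [exact: cont_onN|exact: cont_on_cst].
  by apply: cont_onM; [exact: cont_onN|exact: cont_on_cst].
- move=> w; rewrite MFE => -[Mw|Fw].
    rewrite npsiM//; split.
      rewrite ler_pdivrMr ?mul1r; last by rewrite (lt_le_trans ltr01)// lerDl.
      by rewrite (le_trans (nM w Mw))// lerDl.
    rewrite psiME// /psiM; have gp := (phiD w Mw).2; have r1 := nM w Mw.
    move: gp r1; set z := phi w => gp r1.
    have [z0|z0] := eqVneq z 0; first by rewrite z0 scaler0 /xi eqxx -gp z0.
    have r0 : 0 < nrm2 z by rewrite nrm2_gt0.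
    have /andP[k0 k1] := k01 z z0.
    have i0 : 0 < (1 + K z)^-1 by rewrite invr_gt0 (lt_le_trans ltr01)// lerDl.
    have kE : k ((1 + K z)^-1 *: z) = k z by rewrite /k unitZ.
    rewrite /xi scaler_eq0 (negbTE z0) (gt_eqF i0)/= kE unitZ// nrm2Z ?(ltW i0)//.
    have p1 : 0 < 1 + nrm2 z * k z by rewrite (lt_le_trans ltr01)// lerDl
      mulr_ge0 ?nrm2_ge0.
    rewrite ifT; last first.
      rewrite -mulrA ler_pdivrMl /K//; nra.
    rewrite [X in g (X *: _)](_ : _ = nrm2 z) ?nu//.
    rewrite /K; field.
    rewrite gt_eqF//=; apply/eqP; lra.
  have [Fp Mp n1 mGp [t0 m0]] := projP _ Fw.
  have d0 : 0 < 1 + t w + mG w by rewrite -addrA (lt_le_trans ltr01)// lerDl addr_ge0.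
  have q0 : 0 < (1 + t w) / (1 + t w + mG w) by rewrite divr_gt0// (lt_le_trans
    ltr01)// lerDl.
  rewrite npsiF//; split; first by rewrite ler_pdivrMr// mul1r lerDl.
  have nz : phi (proj w) != 0 by rewrite -nrm2_gt0 n1.
  have kE : k (psiF w) = mG w + t w.
    by rewrite /k /psiF unitZ// unit1// (phiD _ Mp).2.
  rewrite psiFE// /xi [X in if X then _ else _](_ : _ = false); last first.
    by rewrite scaler_eq0 (gt_eqF q0) (negbTE nz).
  rewrite kE {1 2 3 4}/psiF nrm2Z ?(ltW q0)// n1 mulr1 unitZ// unit1//.
  rewrite [X in X <= 1](_ : _ = 1 + t w); last by field; rewrite gt_eqF.
  rewrite (phiD _ Mp).2; case: ifP => t1.
    (* As t is nonnegative, the test 1 + t <= 1 succeeds only on the overlap. *)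
    have t00 : t w = 0 by lra.
    rewrite [X in g (X *: _)](_ : _ = 1); last first.
      rewrite t00 !addr0; have m1 : 1 + mG w != 0 by rewrite gt_eqF//; lra.
      have -> : 1 - 1 / (1 + mG w) * mG w = 1 / (1 + mG w) by field.
      by rewrite divff// mul1r invr_eq0.
    by rewrite scale1r (phiD _ Mp).2 /proj t00 oppr0 slide0.
  rewrite [X in slide _ (X - 1)](_ : _ = 1 + t w); last by field; rewrite gt_eqF.
  by rewrite /proj slide_slide [X in slide _ X](_ : _ = 0) ?slide0//; ring.
- move=> z z1; rewrite MFE /xi; have [z0|z0] := eqVneq z 0.
    have [Mg pg] : M (g 0) /\ phi (g 0) = 0 by apply: gD; apply/ballE; rewrite n0.
    by split; [left|rewrite psiME// /psiM pg scaler0 z0].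
  have [Mb pb /andP[k0 k1] kb] := unitP _ (unitE z z0); rewrite -/(k z) in k0 k1 kb.
  have q0 : 0 < nrm2 z by rewrite nrm2_gt0.
  have uz : unit z != 0 by rewrite -nrm2_gt0 unitE.
  move: z1 q0 (nu z); set q := nrm2 z => z1 q0 nuz /=; case: ifPn => qk.
    have e0 : 0 < 1 - q * k z by lra.
    set r := q / _; have r0 : 0 < r by rewrite divr_gt0.
    have nr : nrm2 (r *: unit z) = r by rewrite nrm2Z ?ltW// unitE// mulr1.
    have [Mg pg] : M (g (r *: unit z)) /\ phi (g (r *: unit z)) = r *: unit z.
      apply: gD; apply/ballE; rewrite nr ler_pdivrMr//; lra.
    split; [by left|rewrite psiME// /psiM pg].
    rewrite /K nr /k unitZ// unit1 ?unitE// -/(k z) scalerA.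
    rewrite [X in X *: _](_ : _ = q)// /r; field.
    by rewrite gt_eqF//= subrK oner_eq0.
  (* From q <= 1 and q (1 + k) > 1; hence the boundary point lies in the facet and can be slid. *)
  have kz : 0 < k z by nra.
  have [Fb mAb] := kb kz; rewrite -ltNge in qk.
  set s := _ - 1; have s0 : 0 < s by rewrite /s; lra.
  have sk : s <= k z by rewrite /s; nra.
  have Fs : F (slide (g (unit z)) s).
    by apply: slideF => //; rewrite mAb add0r divr_ge0// ltW.
  split; [by right|rewrite psiFE// /psiF].
  have ts : t (slide (g (unit z)) s) = s.
    by rewrite /t mA_slide mAb add0r mulrC divfK// gt_eqF.
  rewrite /proj ts slide_slide subrr slide0 pb mG_slide -/(k z).
  rewrite [X in X *: _](_ : _ = q)// /s; field.
  by rewrite gt_eqF//; lra.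
- move=> w; rewrite MFE => -[Mw|Fw].
    have [w0 w1 wD] := (realizationP _ _).1 Mw.
    have p1 : 0 < 1 + K (phi w) by rewrite (lt_le_trans ltr01)// lerDl.
    have r1 := nM w Mw; have K1 := K_ge0 (phi w).
    have kE : nrm2 (phi w) = 1 -> K (phi w) = mG w.
      by move=> e; rewrite /K e mul1r /k unit1// (phiD _ Mw).2.
    rewrite npsiM//; split.
      move=> /realizationP[_ _]; rewrite Bd'E wD/= => /andP[Gw BS].
      have Bw : Defs.support w \in Bd by case/orP: BS => // wS; exact: BdS.
      have e : nrm2 (phi w) = 1 by apply/sphereE/phiB => //; apply/realizationP.
      rewrite e kE// [mG w](_ : _ = 0) ?addr0 ?divr1//.
      apply: le_anti; rewrite mG_ge0// andbT leNgt.
      by move: Gw; rewrite (minon_support gG).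
    (* The norm is at most 1 and K is nonnegative, so norm = 1 + K leaves norm 1 and K = 0. *)
    move=> /divr1_eq e.
    have e1 : nrm2 (phi w) = 1 by lra.
    have mG0 : mG w = 0 by rewrite -kE//; lra.
    have Bw : realization R Bd w by apply/phiB => //; apply/sphereE.
    have [_ _ BwD] := (realizationP _ _).1 Bw.
    apply/realizationP; split => //; rewrite Bd'E wD BwD/= andbT.
    by rewrite (minon_support gG)// -/(mG w) mG0 ltxx.
  have [_ _ _ _ [t0 m0]] := projP _ Fw; rewrite npsiF//.
  have [w0 w1 wS] := (realizationP _ _).1 Fw; rewrite powersetE in wS.
  have d0 : 0 < 1 + t w + mG w by rewrite -addrA (lt_le_trans ltr01)// lerDl addr_ge0.
  split.
    move=> /realizationP[_ _]; rewrite Bd'E => /and3P[_ Gw _].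
    have -> : mG w = 0.
      apply: le_anti; rewrite m0 andbT leNgt.
      by move: Gw; rewrite (minon_support gG).
    by rewrite addr0 divff// gt_eqF// (lt_le_trans ltr01)// lerDl.
  move=> /divr1_eq e.
  have mG0 : mG w = 0 by lra.
  apply/realizationP; split => //; rewrite Bd'E wS !orbT/= andbT.
  by rewrite (minon_support gG)// -/(mG w) mG0 ltxx.
Qed.

End Attach.

(** * Manifold charts *)

Section Charts.
Variable R : realType.

Definition chart_at (n d : nat) (M B : set 'rV[R]_n) (p : 'rV[R]_n) : Prop :=
  exists (U : set 'rV[R]_n) (W : set 'rV[R]_d) f g,
    [/\ open U, U p, open W,
        homeomorphism (M `&` U) (half_space R d `&` W) f g &
        forall x, (M `&` U) x -> (B x <-> half_space_boundary R d (f x))].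
Arguments chart_at {n} d M B p.

Lemma chart_at_homeomorphism n m d (M B : set 'rV[R]_n) (M' B' : set 'rV[R]_m) f g p :
  homeomorphism M M' f g -> (forall x, M x -> (B x <-> B' (f x))) ->
  M p -> chart_at d M' B' (f p) -> chart_at d M B p.
Proof.
move=> [/cont_onP cf /cont_onP cg fM gM] BB' Mp.
move=> [U' [W [f' [g' [oU' U'p oW [/cont_onP cf' /cont_onP cg' f'P g'P] BH]]]]].
pose U := interior [set x | M x -> U' (f x)].
have UP x : M x -> U' (f x) -> U x.
  by move=> Mx U'x; apply: (cf x Mx); apply: open_nbhs_nbhs.
have UE x : M x -> U x -> U' (f x) by move=> Mx Ux; exact: (interior_subset Ux).
exists U, W, (f' \o f), (g \o g'); split => //.
- exact: open_interior.
- exact: UP.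
- split.
  + apply/cont_onP; apply: (@cont_on_comp _ _ _ _ (M' `&` U')) _ cf'.
      by move=> x [Mx Ux]; split; [exact: (fM x Mx).1|exact: UE].
    by apply: cont_on_sub cf => x [].
  + apply/cont_onP; apply: (@cont_on_comp _ _ _ _ M') cg' cg.
    by move=> y /g'P[[]].
  + move=> x [Mx Ux]; have [H e] := f'P _ (conj (fM x Mx).1 (UE x Mx Ux)).
    by split => //=; rewrite e (fM x Mx).2.
  + move=> y /g'P[[M'y U'y] e]; have [Mg eg] := gM _ M'y.
    split; last by rewrite /= eg.
    by split => //; apply: UP => //; rewrite /= eg.
- move=> x [Mx Ux]; rewrite BB'//; apply: BH; split; last exact: UE.
  exact: (fM x Mx).1.
Qed.

Lemma manifold_homeomorphism n m d (M B : set 'rV[R]_n) (M' B' : set 'rV[R]_m) f g :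
  homeomorphism M M' f g -> (forall x, M x -> (B x <-> B' (f x))) -> B `<=` M ->
  manifold_with_boundary d M' B' -> manifold_with_boundary d M B.
Proof.
move=> fg BB' BM [_ chM']; split => // p Mp.
apply: (chart_at_homeomorphism fg BB' Mp); apply: chM'.
by case: fg => _ _ fM _; exact: (fM p Mp).1.
Qed.

Section SignedSwap.
Variables (d : nat) (j : 'I_d.+1) (s : R).
Hypothesis ss : s * s = 1.

Let sgn (i : 'I_d.+1) : R := if i == ord0 then s else 1.
Let sgn2 i : sgn i * sgn i = 1.
Proof. by rewrite /sgn; case: ifP => _; rewrite ?mulr1. Qed.

Definition sswap (x : 'rV[R]_d.+1) : 'rV[R]_d.+1 :=
  \row_i (sgn i * x ord0 (tperm ord0 j i)).
Definition unsswap (x : 'rV[R]_d.+1) : 'rV[R]_d.+1 :=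
  \row_i (sgn (tperm ord0 j i) * x ord0 (tperm ord0 j i)).

Lemma sswapK : cancel sswap unsswap.
Proof. by move=> x; apply/rowP => i; rewrite !mxE tpermK mulrA sgn2 mul1r. Qed.

Lemma unsswapK : cancel unsswap sswap.
Proof. by move=> x; apply/rowP => i; rewrite !mxE tpermK mulrA sgn2 mul1r. Qed.

Lemma nrm2_sswap x : nrm2 (sswap x) = nrm2 x.
Proof.
rewrite /nrm2; congr Num.sqrt;
  rewrite [RHS](reindex_inj (@perm_inj _ (tperm ord0 j)))/=.
by apply: eq_bigr => i _; rewrite mxE exprMn expr2 sgn2 mul1r.
Qed.

Lemma nrm2_unsswap x : nrm2 (unsswap x) = nrm2 x.
Proof. by rewrite -nrm2_sswap unsswapK. Qed.

Lemma sswap_homeomorphism (M : set 'rV[R]_d.+1) :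
  (forall x y, nrm2 x = nrm2 y -> M x -> M y) -> homeomorphism M M sswap unsswap.
Proof.
move=> MP; split.
- apply/cont_onP; apply: cont_on_row => i.
  apply: (@cont_on_ext _ _ _ (fun x : 'rV[R]__ => sgn i * x ord0 (tperm ord0 j i))).
    by move=> x _; rewrite mxE.
  by apply: cont_onM; [exact: cont_on_cst|apply: cont_on_coord; exact: cont_on_id].
- apply/cont_onP; apply: cont_on_row => i.
  apply: (@cont_on_ext _ _ _ (fun x :
    'rV[R]__ => sgn (tperm ord0 j i) * x ord0 (tperm ord0 j i))).
    by move=> x _; rewrite mxE.
  by apply: cont_onM; [exact: cont_on_cst|apply: cont_on_coord; exact: cont_on_id].
- by move=> x Mx; rewrite sswapK; split => //; apply: MP Mx; rewrite nrm2_sswap.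
- by move=> x Mx; rewrite unsswapK; split => //; apply: MP Mx; rewrite nrm2_unsswap.
Qed.

End SignedSwap.

(* Symmetry reduces charts of rotation-invariant sets at a nonzero point to
   charts at points with positive first coordinate. *)
Lemma chart_at_sym d e (M B : set 'rV[R]_d.+1) p :
  (forall x y, nrm2 x = nrm2 y -> M x -> M y) ->
  (forall x y, nrm2 x = nrm2 y -> B x -> B y) ->
  (forall q, M q -> 0 < q ord0 ord0 -> chart_at e M B q) ->
  M p -> p != 0 -> chart_at e M B p.
Proof.
move=> MP BP H Mp p0.
have [j pj] : exists j, p ord0 j != 0.
  apply/existsP; rewrite -negb_forall; apply: contra p0 => /forallP p0.
  by apply/eqP/rowP => i; rewrite mxE; apply/eqP.
pose s : R := if 0 < p ord0 j then 1 else -1.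
have ss : s * s = 1 by rewrite /s; case: ifP => _; ring.
apply: (chart_at_homeomorphism (sswap_homeomorphism j ss MP)) => //.
  move=> x Mx; split; apply: BP; by rewrite nrm2_sswap.
apply: H; first by apply: MP Mp; rewrite nrm2_sswap.
rewrite mxE eqxx tpermL /s; case: ifPn => pj0; first by rewrite mul1r.
by rewrite mulN1r oppr_gt0 lt_neqAle pj leNgt.
Qed.

Lemma open_pos n (f : 'rV[R]_n -> R) : cont_on setT f -> open [set x | 0 < f x].
Proof.
move=> /cont_onT cf; exact: ((continuousP _).1 cf _ (@open_gt _ 0)).
Qed.

Lemma half_space_boundaryS d (y : 'rV[R]_d.+1) :
  half_space_boundary R d.+1 y <-> y ord0 ord0 = 0.
Proof.
split=> [[i [i0 yi]]|y0]; last by exists ord0.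
by rewrite -yi; congr (y _ _); apply: val_inj; rewrite /= i0.
Qed.

Lemma half_spaceS d (y : 'rV[R]_d.+1) : half_space R d.+1 y <-> 0 <= y ord0 ord0.
Proof.
split=> [H|y0 i i0]; first exact: H.
by have -> : i = ord0 by apply: val_inj.
Qed.

(** Translation by the all-ones vector moves the open unit ball into the half-space and off its
    bounding hyperplane, for d = 0 as well. *)
Lemma ball_chart0 d : chart_at d (euclidean_ball R d) (euclidean_sphere R d) 0.
Proof.
pose e : 'rV[R]_d := \row_i 1.
have tr (c : R) : cont_on setT (fun x : 'rV[R]_d => x + c *: e).
  apply: cont_on_row => i;
    apply: (@cont_on_ext _ _ _ (fun x : 'rV[R]__ => x ord0 i + c)).
    by move=> x _; rewrite !mxE mulr1.
  by apply: cont_onD; [apply: cont_on_coord; exact: cont_on_id|exact: cont_on_cst].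
have lt1 (x : 'rV[R]_d) i : 0 < 1 - nrm2 x -> 0 < x ord0 i + 1.
  move=> x1; have := coord_le_nrm2 x i; rewrite ler_norml => /andP[xi _]; lra.
have cn c : cont_on setT (fun x : 'rV[R]_d => 1 - nrm2 (x + c *: e)).
  by apply: cont_onB; [exact: cont_on_cst|apply: cont_on_nrm2; exact: tr].
(* The scalar 0 lets [cn] serve for the openness of both sets. *)
exists [set x | 0 < 1 - nrm2 (x + 0 *: e)], [set y | 0 < 1 - nrm2 (y + (-1) *: e)],
  (fun x => x + 1 *: e), (fun x => x + (-1) *: e).
have K1 (x : 'rV[R]_d) : x + 1 *: e + -1 *: e = x by rewrite scaleN1r scale1r addrK.
have K2 (x : 'rV[R]_d) : x + -1 *: e + 1 *: e = x by rewrite scaleN1r scale1r subrK.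
split.
- exact: open_pos.
- rewrite /= scale0r addr0; have /eqP := nrm2_eq0 (0 : 'rV[R]_d).
  by rewrite eqxx => /eqP/eqP ->; rewrite subr0 ltr01.
- exact: open_pos.
- split.
  + by apply/cont_onP; apply: cont_on_sub (tr 1).
  + by apply/cont_onP; apply: cont_on_sub (tr (-1)).
  + move=> x [_ /=]; rewrite scale0r addr0 K1 => x1; split => //; split => //.
    by move=> i _; rewrite !mxE mulr1 ltW// lt1.
  + move=> y [_ /=]; rewrite scale0r addr0 K2 => y1; split => //; split => //.
    by apply/ballE; lra.
- move=> x [_ /=]; rewrite scale0r addr0 => x1; split.
    by move=> /sphereE xs; move: x1; rewrite xs subrr ltxx.
  move=> [i [_]]; rewrite !mxE mulr1 => xi.
  by have := lt1 x i x1; rewrite xi ltxx.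
Qed.

(** Where the first coordinate is positive, replacing it by 1 - |x|^2 gives a chart: this quantity
    vanishes exactly on the sphere, and a square root recovers the lost coordinate. *)
Lemma ball_manifold d :
  manifold_with_boundary d (euclidean_ball R d) (euclidean_sphere R d).
Proof.
split; first by move=> x /sphereE x1; apply/ballE; rewrite x1.
case: d => [|d] p Mp.
  have -> : p = 0 by apply/rowP => -[].
  exact: ball_chart0.
have [->|p0] := eqVneq p 0; first exact: ball_chart0.
apply: chart_at_sym Mp p0.
- by move=> x y xy /ballE x1; apply/ballE; rewrite -xy.
- by move=> x y xy /sphereE x1; apply/sphereE; rewrite -xy.
move=> q Mq q0.
pose rest (y : 'rV[R]_d.+1) := \sum_(i < d) y ord0 (lift ord0 i) ^+ 2.
pose r (y : 'rV[R]_d.+1) := 1 - y ord0 ord0 - rest y.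
have restE (x : 'rV[R]_d.+1) : nrm2 x ^+ 2 = x ord0 ord0 ^+ 2 + rest x.
  by rewrite nrm2_sqr big_ord_recl.
pose f (x : 'rV[R]_d.+1) : 'rV[R]_d.+1 :=
  \row_i (if i == ord0 then 1 - (x ord0 ord0 ^+ 2 + rest x) else x ord0 i).
pose g (y : 'rV[R]_d.+1) : 'rV[R]_d.+1 :=
  \row_i (if i == ord0 then Num.sqrt (r y) else y ord0 i).
have rest_f x : rest (f x) = rest x.
  by apply: eq_bigr => i _; rewrite mxE.
have rest_g x : rest (g x) = rest x.
  by apply: eq_bigr => i _; rewrite mxE.
have f0 x : f x ord0 ord0 = 1 - (x ord0 ord0 ^+ 2 + rest x) by rewrite mxE eqxx.
have g0 x : g x ord0 ord0 = Num.sqrt (r x) by rewrite mxE eqxx.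
have cc i : cont_on setT (fun x : 'rV[R]_d.+1 => x ord0 i).
  by apply: cont_on_coord; exact: cont_on_id.
have crest : cont_on setT rest.
  by apply: cont_on_sum => i _; apply: cont_onM; exact: cc.
have cr : cont_on setT r.
  by apply: cont_onB => //; apply: cont_onB => //; exact: cont_on_cst.
have cf : cont_on setT f.
  apply: cont_on_row => i; have [->|i0] := eqVneq i ord0.
    apply: (@cont_on_ext _ _ _ (fun x : 'rV[R]__ => 1 - (x ord0 ord0 ^+ 2 + rest x))).
      by move=> x _; rewrite f0.
    apply: cont_onB; first exact: cont_on_cst.
    by apply: cont_onD => //; apply: cont_onM.
  by apply: cont_on_ext (cc i) => x _; rewrite mxE (negbTE i0).
have cg : cont_on setT g.
  apply: cont_on_row => i; have [->|i0] := eqVneq i ord0.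
    apply: (@cont_on_ext _ _ _ (fun x : 'rV[R]__ => Num.sqrt (r x))).
      by move=> x _; rewrite g0.
    apply: (@cont_on_comp _ _ _ setT setT r) => //.
    by apply: cont_onW; exact: sqrt_continuous.
  by apply: cont_on_ext (cc i) => x _; rewrite mxE (negbTE i0).
exists [set x | 0 < x ord0 ord0], [set y | 0 < r y], f, g; split => //.
- exact: open_pos.
- exact: open_pos.
- split.
  + by apply/cont_onP; apply: cont_on_sub cf.
  + by apply/cont_onP; apply: cont_on_sub cg.
  + move=> x [/ballE x1 /= x0].
    have rf : r (f x) = x ord0 ord0 ^+ 2 by rewrite /r rest_f f0; ring.
    split; [split|].
    * apply/half_spaceS; rewrite f0 -restE subr_ge0.
      by rewrite expr_le1// nrm2_ge0.
    * by rewrite /= rf exprn_gt0.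
    * apply/rowP => i; have [->|i0] := eqVneq i ord0.
        by rewrite g0 rf sqrtr_sqr gtr0_norm.
      by rewrite !mxE (negbTE i0).
  + move=> y [/half_spaceS y0 /= ry].
    have gy : g y ord0 ord0 ^+ 2 + rest (g y) = 1 - y ord0 ord0.
      by rewrite rest_g g0 sqr_sqrtr ?ltW// /r; ring.
    split; [split|].
    * apply/ballE; rewrite -(@expr_le1 _ 2)// ?nrm2_ge0// restE gy; lra.
    * by rewrite /= g0 sqrtr_gt0.
    * apply/rowP => i; have [->|i0] := eqVneq i ord0.
        by rewrite f0 gy; ring.
      by rewrite !mxE (negbTE i0).
- move=> x [_ _]; rewrite half_space_boundaryS f0 -restE nrm2_sqr.
  by rewrite /euclidean_sphere /=; split => H; lra.
Qed.

(** The hemisphere of positive first coordinate is projected along that coordinate; the shift by 1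
    makes the remaining coordinates positive, so the image misses the bounding hyperplane. For d = 0
    the sphere is empty. *)
Lemma sphere_manifold d :
  exists e, manifold_with_boundary e (euclidean_sphere R d) set0.
Proof.
case: d => [|d].
  exists 0%N; split => // p; rewrite /euclidean_sphere /= big_ord0 => /eqP.
  by rewrite eq_sym oner_eq0.
exists d; split => // p Mp.
have inv : forall x y : 'rV[R]_d.+1, nrm2 x = nrm2 y ->
    euclidean_sphere R d.+1 x -> euclidean_sphere R d.+1 y.
  by move=> x y xy /sphereE x1; apply/sphereE; rewrite -xy.
have p0 : p != 0 by rewrite -nrm2_gt0 (sphereE _).1.
apply: (chart_at_sym inv) Mp p0 => //.
move=> q Mq q0.
pose f (x : 'rV[R]_d.+1) : 'rV[R]_d := \row_i (x ord0 (lift ord0 i) + 1).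
pose r (y : 'rV[R]_d) := 1 - \sum_i (y ord0 i - 1) ^+ 2.
pose g (y : 'rV[R]_d) : 'rV[R]_d.+1 :=
  \row_i (if unlift ord0 i is Some k then y ord0 k - 1 else Num.sqrt (r y)).
have g0 y : g y ord0 ord0 = Num.sqrt (r y) by rewrite mxE unlift_none.
have gl y i : g y ord0 (lift ord0 i) = y ord0 i - 1 by rewrite mxE liftK.
have fi x i : f x ord0 i - 1 = x ord0 (lift ord0 i) by rewrite mxE addrK.
have cc n i : cont_on setT (fun x : 'rV[R]_n => x ord0 i).
  by apply: cont_on_coord; exact: cont_on_id.
have cr : cont_on setT r.
  apply: cont_onB; first exact: cont_on_cst.
  by apply: cont_on_sum => i _; apply: cont_onM;
    apply: cont_onB => //; exact: cont_on_cst.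
have cf : cont_on setT f.
  apply: cont_on_row => i.
  apply: (@cont_on_ext _ _ _ (fun x : 'rV[R]__ => x ord0 (lift ord0 i) + 1)).
    by move=> x _; rewrite mxE.
  by apply: cont_onD => //; exact: cont_on_cst.
have cg : cont_on setT g.
  apply: cont_on_row => i; case: (unliftP ord0 i) => [k ->|->].
    apply: (@cont_on_ext _ _ _ (fun y : 'rV[R]__ => y ord0 k - 1)) => [x _|].
      by rewrite gl.
    by apply: cont_onB => //; exact: cont_on_cst.
  apply: (@cont_on_ext _ _ _ (fun y : 'rV[R]__ => Num.sqrt (r y))) => [x _|].
    by rewrite g0.
  apply: (@cont_on_comp _ _ _ setT setT r) => //.
  by apply: cont_onW; exact: sqrt_continuous.
have rf x : euclidean_sphere R d.+1 x -> r (f x) = x ord0 ord0 ^+ 2.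
  rewrite /euclidean_sphere /= big_ord_recl /= => xs.
  have -> : r (f x) = 1 - \sum_(i < d) x ord0 (lift ord0 i) ^+ 2.
    by congr (_ - _); apply: eq_bigr => i _; rewrite fi.
  by lra.
have fpos x i : euclidean_sphere R d.+1 x -> 0 < x ord0 ord0 -> 0 < f x ord0 i.
  move=> xs x0; have := rf x xs; rewrite /r (bigD1 i)//=.
  have : 0 <= \sum_(k < d | k != i) (f x ord0 k - 1) ^+ 2.
    by apply: sumr_ge0 => k _; exact: sqr_ge0.
  have : 0 < x ord0 ord0 ^+ 2 by rewrite exprn_gt0.
  move=> A B C; have : (f x ord0 i - 1) ^+ 2 < 1 by lra.
  nra.
exists [set x | 0 < x ord0 ord0], [set y | 0 < r y], f, g; split => //.
- exact: open_pos.
- exact: open_pos.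
- split.
  + by apply/cont_onP; apply: cont_on_sub cf.
  + by apply/cont_onP; apply: cont_on_sub cg.
  + move=> x [xs /= x0]; split; [split|].
    * by move=> i _; rewrite ltW// fpos.
    * by rewrite /= rf// exprn_gt0.
    * apply/rowP => i; case: (unliftP ord0 i) => [k ->|->].
        by rewrite gl fi.
      by rewrite g0 rf// sqrtr_sqr gtr0_norm.
  + move=> y [_ /= ry]; split; [split|].
    * rewrite /euclidean_sphere /= big_ord_recl g0 sqr_sqrtr ?ltW// /r.
      rewrite [X in _ + X](_ : _ = \sum_i (y ord0 i - 1) ^+ 2) ?subrK//.
      by apply: eq_bigr => i _; rewrite gl.
    * by rewrite /= g0 sqrtr_gt0.
    * by apply/rowP => i; rewrite mxE gl subrK.
- move=> x [xs x0]; split => // -[i [_ fx0]].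
  by have := fpos x i xs x0; rewrite fx0 ltxx.
Qed.

End Charts.

(** * The realization of the tableau complex *)

Lemma homeomorphism_trans (S T Z : topologicalType) (A : set S) (B : set T) (C : set Z)
    f g f' g' : homeomorphism A B f g -> homeomorphism B C f' g' ->
  homeomorphism A C (f' \o f) (g \o g').
Proof.
move=> [/cont_onP cf /cont_onP cg fA gB] [/cont_onP cf' /cont_onP cg' fB gC]; split.
- by apply/cont_onP; apply: cont_on_comp cf cf' => x /fA[].
- by apply/cont_onP; apply: cont_on_comp cg' cg => x /gC[].
- by move=> x /fA[Bx e]; have [Cx e'] := fB _ Bx; split => //=; rewrite e' e.
- by move=> x /gC[Bx e]; have [Cx e'] := gB _ Bx; split => //=; rewrite e' e.
Qed.

(** * Realization of a renamed complex *)

Section RelabelRealization.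
Variables (R : realType) (U V : finType) (h : U -> V).
Hypothesis hI : injective h.
Implicit Types (D : {set {set U}}).

Definition pull (w : 'rV[R]_#|V|) : 'rV[R]_#|U| := mkrow (fun p => pt w (h p)).
Definition push (u : 'rV[R]_#|U|) : 'rV[R]_#|V| :=
  mkrow (fun v => \sum_(p | h p == v) pt u p).

Lemma pt_push u p : pt (push u) (h p) = pt u p.
Proof. by rewrite ptK (big_pred1 p)// => q; rewrite /= (inj_eq hI). Qed.

Lemma pushK : cancel push pull.
Proof. by move=> u; apply: ptP => p; rewrite ptK pt_push. Qed.

Lemma sum_push u : \sum_v pt (push u) v = \sum_p pt u p.
Proof.
under eq_bigr do rewrite ptK.
by rewrite [RHS](partition_big h predT).
Qed.

Lemma support_push u : Defs.support (push u) = (h @: Defs.support u)%SET.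
Proof.
apply/setP => v; rewrite in_support; apply/idP/imsetP => [|[p up ->]]; last first.
  by rewrite pt_push -in_support.
rewrite ptK => /eqP sv; have [/existsP[p /andP[/eqP hp up]]|/existsPn nv] :=
    boolP [exists p, (h p == v) && (pt u p != 0)].
  by exists p; rewrite ?in_support.
by case: sv; apply: big1 => p hp; have := nv p; rewrite hp negbK => /eqP.
Qed.

Lemma push_realization D u : realization R (relabel h D) (push u) <-> realization R D u.
Proof.
split=> /realizationP[w0 w1 wD]; apply/realizationP; split.
- by move=> p; rewrite -pt_push.
- by rewrite -sum_push.
- by move: wD; rewrite support_push mem_relabel.
- by move=> v; rewrite ptK; apply: sumr_ge0 => p _.
- by rewrite sum_push.
- by rewrite support_push mem_relabel.
Qed.

Lemma pullK D w : realization R (relabel h D) w -> push (pull w) = w.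
Proof.
move=> /realizationP[_ _ /imsetP[C _ wC]]; apply: ptP => v.
have [/codomP[p ->]|vh] := boolP (v \in codom h); first by rewrite pt_push ptK.
rewrite ptK big1 => [|p /eqP hp]; last by rewrite -hp codom_f in vh.
apply/esym/eqP; rewrite -[_ == _]negbK -in_support wC.
by apply: contra vh => /imsetP[p _ ->]; exact: codom_f.
Qed.

Lemma pull_realization D w : w = push (pull w) ->
  realization R (relabel h D) w <-> realization R D (pull w).
Proof. by move=> {1}->; exact: push_realization. Qed.

Lemma relabel_homeomorphism D :
  homeomorphism (realization R (relabel h D)) (realization R D) pull push.
Proof.
split.
- apply/cont_onP; apply: cont_on_mkrow => p; apply: cont_on_pt; exact: cont_on_id.
- apply/cont_onP; apply: cont_on_mkrow => v; apply: cont_on_sum => p _.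
  apply: cont_on_pt; exact: cont_on_id.
- by move=> w Dw; have e := pullK Dw; split => //; apply/pull_realization.
- by move=> u Du; split; [apply/push_realization|exact: pushK].
Qed.

End RelabelRealization.

(** * Ball or sphere *)

Section OrderBall.
Variables (R : realType) (dX dY : Order.disp_t).
Variables (X : finPOrderType dX) (Y : finOrderType dY).
Variables (Psi : {set X * X}) (E : {set X * Y}).
Hypothesis hPsi : forall x1 x2 : X, (x1, x2) \in Psi -> (x1 < x2)%O.
Hypothesis hE : forall f : {ffun X -> Y},
  f \in order_tableaux Y Psi -> graph f \subset E.
Local Notation T := (order_tableaux Y Psi).

(** One function g inside E and outside T lies outside every ideal, so G is nonempty at each stage
    and the complex remains a ball up to the end. *)
Lemma ideal_ball (T' : {set {ffun X -> Y}}) g : ideal Psi T' -> T' != finset.set0 ->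
  graph g \subset E -> g \notin T ->
  exists d, ball_pair d (realization R (complex T' E)) (realization R (boundary T' E)).
Proof.
move=> + + gE gT; move: {2}#|T'|.+1 (ltnSn #|T'|) => n.
elim: n T' => // n IH T'; rewrite ltnS => le idT T0.
have [f fT fmax] := ideal_maximal T0.
have gT' : g \notin T' by apply: contra gT; apply/fintype.subsetP; exact: idT.1.
pose A := restriction E T' f.
have /finset.set0Pn[g0 g0G] := step_corestriction_neq0 hPsi idT fT fmax gE gT'.
(* With a single tableau A is empty, G is the whole facet, and the boundary is that of a simplex. *)
have [T''0|T''0] := eqVneq (T' :\ f)%SET finset.set0.
  have g0S : g0 \in (E :\: graph f)%SET by move: g0G; rewrite inE => /andP[].
  have [d] := @simplex_ball_pair R _ _ _ g0S; exists d.
  have c0 : complex finset.set0 E = finset.set0.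
    by apply/setP => C; rewrite finset.in_set0; apply/negP => /complexP[e]; rewrite inE.
  have A0 : A = finset.set0.
    by apply/setP => q; rewrite inE T''0 !finset.in_set0 andbF.
  have -> : complex T' E = powerset (E :\: graph f)%SET.
    by rewrite (step_complex E fT) T''0 c0 finset.set0U.
  have -> // : boundary T' E = (powerset (E :\: graph f) :\ (E :\: graph f))%SET.
  apply/setP => C;
    rewrite (step_boundary hPsi hE idT fT fmax) T''0 c0 -/A A0 finset.setD0.
  have -> : C \in boundary finset.set0 E = false.
    by apply/negP => /boundaryP[e [? []]]; rewrite inE.
  rewrite finset.in_set0/= finset.in_setD1 powersetE.
  have [CS|] := boolP (C \subset _); last by rewrite !andbF.
  by rewrite andbT /= andbT finset.eqEsubset CS.
have [] := IH (T' :\ f)%SET _ (ideal_step idT fmax) T''0.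
  by apply: leq_trans le; rewrite [X in (_ < X)%N](cardsD1 f) fT.
move=> d IHd; exists d.
have /finset.set0Pn[a aA] := step_restriction_neq0 hPsi hE idT fT fmax T''0.
rewrite (step_complex E fT).
apply: (@attach_ball_pair _ _ _ _ (boundary (T' :\ f)%SET E) _ _ A
  ((E :\: graph f) :\: A)%SET a g0) => //.
- exact: complex_simplicial.
- by apply/fintype.subsetP => p; rewrite inE => /andP[].
- by move=> C CS; exact: (step_facet hPsi hE idT fT fmax).
- by move=> C CS; exact: (step_boundary_facet hE idT fT).
- by move=> C; exact: (step_boundary_interior hPsi idT fT fmax).
- by move=> C; exact: (step_boundary hPsi hE idT fT fmax).
Qed.

(** The blocks are the sets of entries of E over each x. A subset of E misses an entry of every
    block exactly when some function inside E avoids it, and all these functions are tableaux. *)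
Lemma full_sphere : T != finset.set0 ->
  (forall g : {ffun X -> Y}, graph g \subset E -> g \in T) ->
  exists d, homeomorphic (realization R (complex T E)) (euclidean_sphere R d).
Proof.
move=> /finset.set0Pn[f0 f0T] all.
apply: (@block_join_sphere R _ X E fst (fun x => (x, f0 x))) => //.
  by move=> x; apply: (fintype.subsetP (hE f0T)); rewrite in_graph.
move=> C; apply: (iffP (complexP _ _ _)) => [[f fT Cf]|[CE H]].
  split; first by apply: fintype.subset_trans Cf (finset.subsetDl _ _).
  move=> x; exists (x, f x) => //; rewrite finset.in_setD.
  rewrite (fintype.subsetP (hE fT)) ?in_graph// andbT.
  by apply/negP => /(fintype.subsetP Cf); rewrite finset.in_setD in_graph eqxx.
(* The condition on C makes [pick] succeed at every x, so the default [f0 x] is never taken. *)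
pose g : {ffun X -> Y} := [ffun x => odflt (f0 x) [pick y | (x, y) \in (E :\: C)%SET]].
have gC x : (x, g x) \in (E :\: C)%SET.
  rewrite ffunE; case: pickP => //= none.
  by have [[x' y] pC /= xE] := H x; rewrite xE none in pC.
have gP p : p \in graph g -> p \in (E :\: C)%SET.
  by case: p => x y; rewrite in_graph /= => /eqP <-; exact: gC.
exists g; first by apply: all; apply/fintype.subsetP => p /gP;
  rewrite finset.in_setD => /andP[].
apply/fintype.subsetP => p pC; rewrite finset.in_setD (fintype.subsetP CE)// andbT.
by apply/negP => /gP; rewrite finset.in_setD pC.
Qed.

End OrderBall.

Theorem theorem1p2 (R : realType) (dX dY : Order.disp_t)
    (X : finPOrderType dX) (Y : finOrderType dY)
    (Psi : {set X * X}) (E : {set X * Y})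
    (hPsi : forall x1 x2 : X, (x1, x2) \in Psi -> (x1 < x2)%O)
    (hE : forall f : {ffun X -> Y},
        f \in order_tableaux Y Psi -> graph f \subset E) :
  let T := order_tableaux Y Psi in
  let Delta := tableau_complex T E in
  [/\ (exists d : nat, homeomorphic (realization R Delta) (euclidean_ball R d))
      \/ (exists d : nat,
            homeomorphic (realization R Delta) (euclidean_sphere R d)),
      vertex_decomposable Delta /\ shellable Delta &
      (exists d : nat,
         manifold_with_boundary d (realization R Delta)
           (realization R (boundary_complex Delta)))
      /\ (forall F : {set X * Y}, is_face T E F ->
            (interior_face Delta (face_of E F) <->
             forall f : {ffun X -> Y}, graph f \subset F -> f \in T))].
Proof.
move=> T Delta.
have hI := @vlabel_inj X Y E.
have DE : Delta = relabel (vlabel E) (complex T E) by exact: tableau_complexE.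
have BE : boundary_complex Delta = relabel (vlabel E) (boundary T E).
  by rewrite DE boundary_complex_relabel// boundary_complexE.
have vd : vertex_decomposable Delta /\ shellable Delta.
  split; last exact: order_shellable.
  by rewrite DE; apply: vertex_decomposable_relabel => //;
    exact: order_vertex_decomposable.
have int F : is_face T E F -> (interior_face Delta (face_of E F) <->
    forall f : {ffun X -> Y}, graph f \subset F -> f \in T).
  exact: order_interior_face.
have BM : realization R (boundary T E) `<=` realization R (complex T E).
  move=> w /realizationP[w0 w1 wB]; apply/realizationP; split => //.
  by move: wB; rewrite inE => /andP[].
have hom := relabel_homeomorphism R hI (complex T E); rewrite -DE in hom.
have homB w : realization R Delta w ->
    (realization R (boundary_complex Delta) w <->
     realization R (boundary T E) (pull (vlabel E) w)).
  move=> Dw; rewrite BE; apply: pull_realization => //; apply/esym.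
  by move: Dw; rewrite DE; exact: pullK.
have BDelta : realization R (boundary_complex Delta) `<=` realization R Delta.
  rewrite BE DE => w Bw; have e := pullK hI Bw.
  by apply/pull_realization => //; apply: BM; apply/pull_realization.
(* Without tableaux the realization is empty: the sphere for d = 0. *)
have [T0|T0] := eqVneq T finset.set0.
  have D0 w : ~ realization R Delta w.
    move=> /realizationP[_ _]; rewrite DE => /imsetP[C /complexP[f]].
    by rewrite T0 inE.
  split => //; last first.
    by split => //; exists 0%N; split => // p /D0.
  right; exists 0%N, (fun=> 0), (fun=> 0); split.
  - by apply/cont_onP => w /D0.
  - by apply/cont_onP; exact: cont_on_cst.
  - by move=> w /D0.
  - move=> z; rewrite /euclidean_sphere /= big_ord0 => /eqP.
    by rewrite eq_sym oner_eq0.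
(* A function inside E and outside T leads to a ball; if there is none, to a sphere. *)
have [/existsP[g /andP[gE gT]]|/existsPn all] :=
    boolP [exists g : {ffun X -> Y}, (graph g \subset E) && (g \notin T)].
  have [d [phi [psi [hb hB]]]] := ideal_ball R hPsi hE (ideal_full Y Psi) T0 gE gT.
  split => //.
    by left; exists d, (phi \o pull (vlabel E)), (push (vlabel E) \o psi);
      exact: homeomorphism_trans hb.
  split => //; exists d.
  apply: (manifold_homeomorphism (homeomorphism_trans hom hb)) => //;
    last exact: ball_manifold.
  move=> w Dw; rewrite homB//; apply: hB.
  by case: hom => _ _ H _; exact: (H w Dw).1.
have {}all g : graph g \subset E -> g \in T.
  by move=> gE; have := all g; rewrite gE negbK.
have [d [phi [psi hs]]] := full_sphere R hE T0 all.
split => //.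
  by right; exists d, (phi \o pull (vlabel E)), (push (vlabel E) \o psi);
    exact: homeomorphism_trans hs.
split => //; have [e me] := sphere_manifold R d; exists e.
apply: (manifold_homeomorphism (homeomorphism_trans hom hs)) me => //.
(* Every function inside E is a tableau, so the boundary is void. *)
move=> w Dw; rewrite homB//;
  split => // /realizationP[_ _ /boundaryP[f [g [_ gT gE _ _]]]].
by rewrite all in gT.
Qed.
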